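(* Let $R$ be a symmetric graded root with involution $J_0$. Then $(C_*(R),J_0)$ is locally equivalent to $(C_*(M),J_0)$, where $M$ is the monotone subroot of $R$ (defined in the context).
   Context: $\mathbb F=\mathbb Z/2$; $\deg U=-2$. Graded roots. A graded root is an infinite tree $R$ with $\chi:\mathrm{Vert}(R)\to\mathbb Q$ such that: $\chi(u)-\chi(v)=\pm1$ for each edge $(u,v)$; $\chi(u)<\max\{\chi(v),\chi(w)\}$ for edges $(u,v),(u,w)$ with $v\ne w$; $\chi$ is bounded above; $\chi^{-1}(q)$ is finite for all $q$; $\#\chi^{-1}(q)=1$ for $q\ll0$ (among values congruent mod $\mathbb Z$ to those attained). The degree of $v$ is $\mathrm{gr}(v)=2\chi(v)$. A symmetric graded root is a graded root with a $\chi$-preserving graph involution $J_0$ such that for each $q\in\mathbb Q$ there is at most one $J_0$-invariant vertex $v$ with $\chi(v)=q$. It can be drawn in the plane, opening upward, symmetrically about the vertical stem of $J_0$-invariant vertices, so that $J_0$ is the reflection. Standard complex. Let $v_1,\dots,v_n$ be the leaves of $R$ in left-to-right order in a symmetric planar drawing (so $J_0v_i=v_{n+1-i}$). For $1\le i\le n-1$ let $\mathrm{gr}(\alpha_i)$ be the degree of the highest vertex at which the degree-decreasing infinite paths from $v_i$ and $v_{i+1}$ meet. $C_*(R)$ is the free $\mathbb F[U]$-complex with generators $v_i$ in degree $\mathrm{gr}(v_i)$ and $\alpha_i$ in degree $\mathrm{gr}(\alpha_i)+1$, with $\partial v_i=0$, $\partial\alpha_i=U^{(\mathrm{gr}(v_i)-\mathrm{gr}(\alpha_i))/2}v_i+U^{(\mathrm{gr}(v_{i+1})-\mathrm{gr}(\alpha_i))/2}v_{i+1}$,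 and $J_0$ acts $\mathbb F[U]$-linearly by $v_i\mapsto v_{n-i+1}$, $\alpha_i\mapsto\alpha_{n-i}$. When the number of leaves is odd, the convention is to modify this complex by replacing the generator of the $J_0$-invariant middle leaf $v$ by two copies in degree $\mathrm{gr}(v)$ (left and right, swapped by $J_0$), together with an extra $J_0$-fixed odd generator in degree $\mathrm{gr}(v)+1$ whose boundary is the sum of the two copies. Monotone roots. Given rational numbers $h_1>\dots>h_n$ and $r_1<\dots<r_n$, all differing by even integers, with $h_n\ge r_n$, the monotone root $M(h_1,r_1;\dots;h_n,r_n)$ is the symmetric graded root consisting of an infinite stem (one $J_0$-invariant vertex in each degree $r_n,r_n-2,\dots$) and, for each $i$ with $h_i>r_i$, a symmetric pair of leaves $v_i,J_0v_i$ in degree $h_i$ joined to the stem by a pair of paths meeting the stem in degree $r_i$; if $h_n=r_n$, then $v_n$ is the top stem vertex. Monotone subroot of $R$. The stem of $R$ is the set of $J_0$-invariant vertices. For a vertex $v$ let $\gamma_v$ be the degree-decreasing infinite path from $v$; its base $b(v)$ is the maximal degree of a vertex in $\gamma_v\cap$ stem. The cluster $C_b$ is the set of vertices with base $b$; it is nontrivial if it has more than one vertex, and then its tips are a chosen pair of distinct leaves $v,J_0v$ in $C_b$ of maximal degree among vertices of $C_b$. Build a set $S$ of leaves as follows. Let $r$ be the degree of the uppermost stem vertex; if $C_r$ is trivial add that vertex to $S$, otherwise add the two tips of $C_r$. Then go through the nontrivial clusters $C_b$, $b<r$, in order of decreasing $b$, adding the tips of $C_b$ to $S$ exactly when their degree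 is strictly greater than the degrees of all vertices currently in $S$. $M$ is the smallest graded subroot of $R$ containing $S$ (the union of the paths $\gamma_v$, $v\in S$); it is a monotone root with the induced involution $J_0$. Local equivalence. An $\iota$-complex $(C,\iota)$ consists of a $\mathbb Q$-graded, finitely generated, free chain complex $C$ over $\mathbb F[U]$, supported in degrees differing from some $\tau\in\mathbb Q$ by integers, with $U^{-1}H_*(C)\cong\mathbb F[U,U^{-1}]$ relatively graded and supported in degrees differing from $\tau$ by even integers, together with a grading-preserving chain map $\iota$ with $\iota^2\simeq\mathrm{id}$. $(C,\iota)$ and $(C',\iota')$ are locally equivalent if there are grading-preserving ($\mathbb F[U]$-equivariant) chain maps $F:C\to C'$, $G:C'\to C$ with $F\circ\iota\simeq\iota'\circ F$, $G\circ\iota'\simeq\iota\circ G$ ($\mathbb F[U]$-equivariant chain homotopy), and such that $F$ and $G$ induce isomorphisms on homology after inverting $U$. *)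

(* Defs.v *)
From HB Require Import structures.
From mathcomp Require Import all_boot all_order all_algebra.
From mathcomp Require Import boolp classical_sets.
From mathcomp Require Import ring lra.

Set Implicit Arguments.
Unset Strict Implicit.
Unset Printing Implicit Defensive.

Import Order.TTheory GRing.Theory Num.Theory.
Local Open Scope ring_scope.
Local Open Scope quotient_scope.

(* The variable 'X of the polynomial ring plays the role of U. *)
Notation FU := {poly 'F_2}.

Notation free_mod I := {ffun I -> FU^o}.

Definition lin_ext (I J : finType) (f : I -> free_mod J) (x : free_mod I) :
  free_mod J := \sum_i (x i : FU) *: f i.

Lemma lin_ext_is_linear (I J : finType) (f : I -> free_mod J) :
  linear (lin_ext f).
Proof.
move=> a x y; rewrite /lin_ext scaler_sumr -big_split /=; apply: eq_bigr => i _.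
by rewrite !ffunE scalerDl scalerA.
Qed.

HB.instance Definition _ (I J : finType) (f : I -> free_mod J) :=
  GRing.isLinear.Build FU (free_mod I) (free_mod J) *:%R (lin_ext f)
    (lin_ext_is_linear f).

Definition basis_vec (I : finType) (i : I) : free_mod I :=
  [ffun j => ((j == i)%:R : FU)].

(* Since deg U = -2, the element U^k e_i has degree deg i - 2k.  As usual, 0 is
   homogeneous of every degree. *)
Definition homog (I : finType) (deg : I -> rat) (q : rat) (x : free_mod I) :=
  forall i k, (x i : FU)`_k != 0 -> deg i - 2 * k%:R = q.

Definition homog_poly (q : rat) (p : FU^o) :=
  forall k, (p : FU)`_k != 0 -> - (2 * k%:R) = q.

Section Localization.
Variable V : lmodType FU.
Implicit Types (a b c : V * nat) (v w : V).

(* The pair (v, k) represents U^-k v. *)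
Definition loc_eqv a b : bool :=
  `[< exists m, 'X^(m + b.2) *: a.1 = 'X^(m + a.2) *: b.1 >].

Lemma loc_eqv_refl : reflexive loc_eqv.
Proof. by move=> a; apply/asboolP; exists 0. Qed.

Lemma loc_eqv_sym : symmetric loc_eqv.
Proof. by move=> a b; apply/asboolP/asboolP => -[m e]; exists m. Qed.

Lemma loc_eqv_trans : transitive loc_eqv.
Proof.
move=> b a c /asboolP [m e] /asboolP [l f]; apply/asboolP.
exists (m + l + b.2)%N.
have -> : 'X^(m + l + b.2 + c.2) *: a.1 = 'X^(l + c.2) *: ('X^(m + b.2) *: a.1).
  by rewrite scalerA -exprD; congr (_ ^+ _ *: _); ring.
rewrite e scalerA mulrC -scalerA f scalerA -exprD.
by congr (_ ^+ _ *: _); ring.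
Qed.

Canonical loc_equiv := EquivRel loc_eqv loc_eqv_refl loc_eqv_sym loc_eqv_trans.

Definition loc := {eq_quot loc_equiv}.
HB.instance Definition _ := EqQuotient.on loc.
HB.instance Definition _ := Choice.on loc.

Definition frac v (k : nat) : loc := \pi_loc (v, k).

Lemma fracP v k w l :
  frac v k = frac w l <-> exists m, 'X^(m + l) *: v = 'X^(m + k) *: w.
Proof. by split=> [/eqquotP/asboolP|e]; last by apply/eqquotP/asboolP. Qed.

Definition loc_num (x : loc) : V := (repr x).1.
Definition loc_den (x : loc) : nat := (repr x).2.

Lemma fracK x : frac (loc_num x) (loc_den x) = x.
Proof. by rewrite /frac -surjective_pairing reprK. Qed.

Definition loc_add (x y : loc) :=
  frac ('X^(loc_den y) *: loc_num x + 'X^(loc_den x) *: loc_num y) (loc_den x + loc_den y).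
Definition loc_opp (x : loc) := frac (- loc_num x) (loc_den x).
Definition loc_scale (p : FU) (x : loc) := frac (p *: loc_num x) (loc_den x).

Lemma add_frac v k w l :
  loc_add (frac v k) (frac w l) = frac ('X^l *: v + 'X^k *: w) (k + l).
Proof.
have /fracP [m e] := fracK (frac v k); have /fracP [n f] := fracK (frac w l).
apply/fracP; exists (m + n)%N; set x := frac v k in e *; set y := frac w l in f *.
rewrite !scalerDr !scalerA -!exprD; congr (_ + _).
  transitivity ('X^(n + l + loc_den y) *: ('X^(m + k) *: loc_num x)).
    by rewrite scalerA -exprD; congr (_ ^+ _ *: _); ring.
  by rewrite e scalerA -exprD; congr (_ ^+ _ *: _); ring.
transitivity ('X^(m + k + loc_den x) *: ('X^(n + l) *: loc_num y)).
  by rewrite scalerA -exprD; congr (_ ^+ _ *: _); ring.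
by rewrite f scalerA -exprD; congr (_ ^+ _ *: _); ring.
Qed.

Lemma opp_frac v k : loc_opp (frac v k) = frac (- v) k.
Proof.
by have /fracP [m e] := fracK (frac v k); apply/fracP; exists m;
   rewrite !scalerN e.
Qed.

Lemma scale_frac p v k : loc_scale p (frac v k) = frac (p *: v) k.
Proof.
have /fracP [m e] := fracK (frac v k); apply/fracP; exists m.
by rewrite scalerA mulrC -scalerA e !scalerA mulrC.
Qed.

Lemma loc_addA : associative loc_add.
Proof.
move=> x y z; rewrite -(fracK x) -(fracK y) -(fracK z) !add_frac addnA.
congr frac; rewrite !scalerDr !scalerA -!exprD addrA.
by congr (_ ^+ _ *: _ + _ ^+ _ *: _ + _ ^+ _ *: _); ring.
Qed.

Lemma loc_addC : commutative loc_add.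
Proof.
by move=> x y; rewrite -(fracK x) -(fracK y) !add_frac addrC addnC.
Qed.

Lemma loc_add0 : left_id (frac 0 0) loc_add.
Proof.
by move=> x; rewrite -(fracK x) add_frac scaler0 add0r expr0 scale1r.
Qed.

Lemma loc_addN : left_inverse (frac 0 0) loc_opp loc_add.
Proof.
move=> x; rewrite -(fracK x) opp_frac add_frac scalerN addNr.
by apply/fracP; exists 0; rewrite !scaler0.
Qed.

HB.instance Definition _ :=
  GRing.isZmodule.Build loc loc_addA loc_addC loc_add0 loc_addN.

Lemma loc_scaleA p q x : loc_scale p (loc_scale q x) = loc_scale (p * q) x.
Proof. by rewrite -(fracK x) !scale_frac scalerA. Qed.

Lemma loc_scale1 : left_id 1 loc_scale.
Proof. by move=> x; rewrite -(fracK x) scale_frac scale1r. Qed.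

Lemma loc_scaleDr : right_distributive loc_scale +%R.
Proof.
move=> p x y; rewrite -(fracK x) -(fracK y) /GRing.add /= add_frac !scale_frac.
rewrite add_frac scalerDr !scalerA; congr frac.
by congr (_ *: _ + _ *: _); rewrite mulrC.
Qed.

Lemma loc_scaleDl x : {morph loc_scale^~ x : p q / p + q}.
Proof.
move=> p q; rewrite -(fracK x) [RHS]/GRing.add /= !scale_frac add_frac.
rewrite -scalerDr -scalerDl; apply/fracP; exists 0.
by rewrite scalerA -exprD.
Qed.

HB.instance Definition _ := GRing.Zmodule_isLmodule.Build FU loc
  loc_scaleA loc_scale1 loc_scaleDr loc_scaleDl.

Definition loc_homog (hV : rat -> V -> Prop) (q : rat) (x : loc) :=
  exists v k, hV (q - 2 * k%:R) v /\ x = frac v k.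

End Localization.

Definition loc_map (V W : lmodType FU) (f : V -> W) (x : loc V) : loc W :=
  frac (f (loc_num x)) (loc_den x).

Notation Laurent := (loc FU^o).

Record gcomplex := GComplex {
  gen : finType;
  gdeg : gen -> rat;
  bd : {linear free_mod gen -> free_mod gen};
  bd_homog : forall q x, homog gdeg q x -> homog gdeg (q - 1) (bd x);
  bd_bd : forall x, bd (bd x) = 0 }.

Notation module_of C := (free_mod (gen C)).

Section Homology.
Variable C : gcomplex.

Definition cycles : {pred module_of C} := [pred x | bd C x == 0].

Lemma cycles_submod_closed : submod_closed cycles.
Proof.
split=> [|a x y]; rewrite !inE ?raddf0 // => /eqP ex /eqP ey.
by rewrite linearP ex ey scaler0 addr0.
Qed.

HB.instance Definition _ :=
  GRing.isSubmodClosed.Build FU (module_of C) cycles cycles_submod_closed.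

Record cycle := Cycle { cycle_val :> module_of C; _ : cycle_val \in cycles }.

HB.instance Definition _ := [isSub for cycle_val].
HB.instance Definition _ := [Choice of cycle by <:].
HB.instance Definition _ := [SubChoice_isSubLmodule of cycle by <:].

Definition boundaries : {pred cycle} :=
  fun z => `[< exists y, bd C y = cycle_val z >].

Lemma boundaries_submod_closed : submod_closed boundaries.
Proof.
split=> [|a x y]; first by apply/asboolP; exists 0; rewrite raddf0.
move=> /asboolP [u eu] /asboolP [v ev]; apply/asboolP; exists (a *: u + v).
by rewrite linearP eu ev.
Qed.

HB.instance Definition _ :=
  GRing.isSubmodClosed.Build FU cycle boundaries boundaries_submod_closed.

Definition homology := Quotient.quot boundaries.
HB.instance Definition _ := GRing.Zmodule.on homology.
HB.instance Definition _ := EqQuotient.on homology.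

Definition hclass (z : cycle) : homology := \pi_homology z.

Lemma hclassP z w : hclass z = hclass w <-> exists y, bd C y = z - w.
Proof.
rewrite /hclass; split.
  move=> /eqP; rewrite -Quotient.idealrBE => /asboolP [y e]; exists y.
  by rewrite e.
by move=> [y e]; apply/eqP; rewrite -Quotient.idealrBE; apply/asboolP; exists y.
Qed.

Definition homology_scale (p : FU) (x : homology) : homology :=
  hclass (p *: repr x).

Lemma hclassK x : hclass (repr x) = x.
Proof. exact: reprK. Qed.

Lemma hclassD z w : hclass (z + w) = hclass z + hclass w.
Proof. by rewrite /hclass raddfD. Qed.

Lemma scale_hclass p z : homology_scale p (hclass z) = hclass (p *: z).
Proof.
have /hclassP [y e] := hclassK (hclass z); apply/hclassP; exists (p *: y).
by rewrite linearZ /= e scalerBr.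
Qed.

Lemma homology_scaleA p q x :
  homology_scale p (homology_scale q x) = homology_scale (p * q) x.
Proof. by rewrite -(hclassK x) !scale_hclass scalerA. Qed.

Lemma homology_scale1 : left_id 1 homology_scale.
Proof. by move=> x; rewrite -(hclassK x) scale_hclass scale1r. Qed.

Lemma homology_scaleDr : right_distributive homology_scale +%R.
Proof.
move=> p x y; rewrite -(hclassK x) -(hclassK y) -hclassD !scale_hclass.
by rewrite scalerDr hclassD.
Qed.

Lemma homology_scaleDl x : {morph homology_scale^~ x : p q / p + q}.
Proof.
by move=> p q; rewrite -(hclassK x) !scale_hclass scalerDl hclassD.
Qed.

HB.instance Definition _ := GRing.Zmodule_isLmodule.Build FU homology
  homology_scaleA homology_scale1 homology_scaleDr homology_scaleDl.

Definition homology_homog (q : rat) (x : homology) :=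
  exists2 z : cycle, homog (@gdeg C) q z & x = hclass z.

End Homology.

(* The map induced on homology by f.  It is meaningful when f is a chain map; in
   general a cycle whose image is not a cycle is sent to 0. *)
Definition homology_map (C D : gcomplex) (f : module_of C -> module_of D)
  (x : homology C) : homology D :=
  hclass (insubd (0 : cycle D) (f (repr x))).

Definition localized_homology (C : gcomplex) := loc (homology C).

Definition localized_homology_map (C D : gcomplex)
  (f : module_of C -> module_of D) :
  localized_homology C -> localized_homology D := loc_map (homology_map f).

Definition graded_chain_map (C D : gcomplex)
  (f : {linear module_of C -> module_of D}) :=
  (forall x, f (bd C x) = bd D (f x)) /\
  (forall q x, homog (@gdeg C) q x -> homog (@gdeg D) q (f x)).

Definition chain_homotopic (C D : gcomplex)
  (f g : module_of C -> module_of D) :=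
  exists h : {linear module_of C -> module_of D},
    (forall q x, homog (@gdeg C) q x -> homog (@gdeg D) (q + 1) (h x)) /\
    (forall x, f x - g x = bd D (h x) + h (bd C x)).

Definition differ_by_even (p q : rat) := exists m : int, p - q = 2 * m%:~R.

(* sigma is the degree of the element of U^-1 H corresponding to 1: the
   isomorphism with F[U, U^-1] is only relatively graded. *)
Definition iota_complex (C : gcomplex)
  (iota : {linear module_of C -> module_of C}) :=
  (exists tau : rat,
     (forall i : gen C, gdeg i - tau \is a Num.int) /\
     exists sigma (phi : {linear localized_homology C -> Laurent}),
       [/\ differ_by_even sigma tau, bijective phi &
           forall q x, loc_homog (@homology_homog C) q x <->
                       loc_homog homog_poly (q - sigma) (phi x)]) /\
  graded_chain_map iota /\
  chain_homotopic (iota \o iota) idfun.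

Definition local_map (C D : gcomplex)
  (iC : {linear module_of C -> module_of C})
  (iD : {linear module_of D -> module_of D})
  (f : {linear module_of C -> module_of D}) :=
  [/\ graded_chain_map f,
      chain_homotopic (f \o iC) (iD \o f) &
      bijective (localized_homology_map f)].

Definition locally_equivalent (C : gcomplex)
  (iC : {linear module_of C -> module_of C}) (D : gcomplex)
  (iD : {linear module_of D -> module_of D}) :=
  [/\ iota_complex iC, iota_complex iD,
      exists f, local_map iC iD f &
      exists g, local_map iD iC g].

Record graded_root := GradedRoot {
  vert :> choiceType;
  edge : rel vert;
  chi : vert -> rat;
  edge_sym : symmetric edge;
  root_tree : forall u v, exists! p,
    [&& path edge u p, last u p == v & uniq (u :: p)];
  root_infinite : forall s : seq vert, exists v, v \notin s;
  chi_edge : forall u v, edge u v -> chi u - chi v = 1 \/ chi u - chi v = - 1;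
  chi_max : forall u v w, edge u v -> edge u w -> v != w ->
    chi u < Num.max (chi v) (chi w);
  chi_bounded : exists B, forall v, chi v <= B;
  chi_fibre : forall q, exists s : seq vert, forall v, chi v = q -> v \in s;
  chi_low : exists B, forall q, q <= B ->
    (exists v, chi v - q \is a Num.int) -> exists! v, chi v = q }.

Section GradedRoot.
Variable R : graded_root.
Implicit Types (u v w : R) (g : nat -> R).

Definition gr v : rat := 2 * chi v.

Definition leaf v := exists! w, edge v w.

Definition descending_ray g :=
  forall k, edge (g k) (g k.+1) /\ chi (g k.+1) < chi (g k).

(* w lies on the infinite descending path gamma_v. *)
Definition on_gamma v w :=
  exists g, [/\ descending_ray g, g 0 = v & exists k, g k = w].

Definition highest_meet u v w :=
  [/\ on_gamma u w, on_gamma v w &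
      forall w', on_gamma u w' -> on_gamma v w' -> gr w' <= gr w].

(* The default value u is never used, see meetP. *)
Definition meet u v : R := xget u (highest_meet u v).

Lemma simple_path_up u v p : edge u v -> chi u < chi v -> path (@edge R) v p ->
  uniq [:: u, v & p] -> chi u < chi (last v p).
Proof.
elim: p u v => [|w p IHp] u v euv cuv //= /andP [evw pw] un.
have cvw : chi v < chi w.
  have uw : u != w by apply: contraTneq un => ->; rewrite !inE eqxx orbT.
  have := chi_max (etrans (edge_sym v u) euv) evw uw.
  by rewrite lt_max => /orP [/lt_trans/(_ cuv)|//]; rewrite ltxx.
apply: lt_trans cuv _; apply: (IHp v w) => //.
by case/andP: un.
Qed.

Lemma path_int u p : path (@edge R) u p -> chi u - chi (last u p) \is a Num.int.
Proof.
elim: p u => [|w p IHp] u /=; first by rewrite subrr.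
move=> /andP [euw /IHp iw]; rewrite -(subrK (chi w) (chi u)) -addrA rpredD //.
by case: (chi_edge euw) => ->.
Qed.

Lemma chi_int u v : chi u - chi v \is a Num.int.
Proof.
have [p [/and3P [pu /eqP <- _] _]] := root_tree u v; exact: path_int.
Qed.

Lemma low_vertex u : exists B, forall n, chi u - n%:R <= B ->
  exists! v, chi v = chi u - n%:R.
Proof.
have [B lB] := chi_low R; exists B => n /lB; apply; exists u.
by rewrite opprB addrC subrK.
Qed.

Lemma lower_neighbor u : exists v, edge u v /\ chi v < chi u.
Proof.
have [B lB] := low_vertex u.
have [n nB] : exists n : nat, (0 < n)%N /\ chi u - n%:R <= B.
  exists (Num.truncn `|chi u - B|).+1; split => //.
  rewrite lerBlDl -lerBlDr; apply: le_trans (ler_norm _) (ltW _).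
  by rewrite truncnS_gt.
have [v [cv _]] := lB n nB.2.
have n0 : 0 < n%:R :> rat by rewrite ltr0n nB.1.
have cvu : chi v < chi u by rewrite cv; lra.
have [[|w p] [/and3P [/= pu /eqP lv un] _]] := root_tree u v.
  by rewrite -lv ltxx in cvu.
case/andP: pu => euw pw; exists w; split=> //.
case: (chi_edge euw) => e; first by rewrite -subr_gt0 e.
suff: chi u < chi v by rewrite ltNge (ltW cvu).
by rewrite -lv; apply: simple_path_up euw _ pw un; lra.
Qed.

Lemma exists_ray v : exists g, descending_ray g /\ g 0 = v.
Proof.
have [f fP] := choice lower_neighbor.
by exists (fun k => iter k f v); split=> // k; rewrite iterS; exact: fP.
Qed.

Lemma ray_chi g k : descending_ray g -> chi (g k) = chi (g 0) - k%:R.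
Proof.
move=> rg; elim: k => [|k IHk]; first by rewrite subr0.
have [e lt_chi] := rg k; rewrite -natr1 opprD addrA -IHk.
by case: (chi_edge e) => ?; lra.
Qed.

Lemma on_gamma_chi v w : on_gamma v w -> exists k : nat, chi w = chi v - k%:R.
Proof. by move=> [g [rg <- [k <-]]]; exists k; exact: ray_chi. Qed.

Lemma common_vertex u v : exists w, on_gamma u w /\ on_gamma v w.
Proof.
have [g [rg g0]] := exists_ray u; have [h [rh h0]] := exists_ray v.
have [B lB] := low_vertex u.
have [m em] := intrP (chi_int u v).
pose n := (Num.truncn `|chi u - B|).+1.
have nB : chi u - n%:R <= B.
  rewrite lerBlDl -lerBlDr; apply: le_trans (ler_norm _) (ltW _).
  by rewrite truncnS_gt.
pose k := (n + `|m|)%N.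
have kB : chi u - k%:R <= B.
  by apply: le_trans nB; rewrite lerD2l lerN2 ler_nat leq_addr.
have [l el] : exists l : nat, chi v - l%:R = chi u - k%:R.
  exists `|k%:Z - m|%N; rewrite natr_absz ger0_norm.
    by rewrite rmorphB /= -em pmulrn; lra.
  by rewrite subr_ge0 /k PoszD abszE; apply: le_trans (ler_norm m) _; rewrite lerDr.
have [w [_ uw]] := lB k kB.
exists w; split; first by exists g; split=> //; exists k; apply/esym/uw;
  rewrite ray_chi // g0.
by exists h; split=> //; exists l; apply/esym/uw; rewrite ray_chi // h0.
Qed.

Lemma meetP u v : highest_meet u v (meet u v).
Proof.
apply: xgetPex.
pose P (k : nat) := `[< exists w,
  [/\ on_gamma u w, on_gamma v w & chi w = chi u - k%:R] >].
have exP : exists k, P k.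
  have [w [uw vw]] := common_vertex u v; have [k ek] := on_gamma_chi uw.
  by exists k; apply/asboolP; exists w.
case: (ex_minnP exP) => k /asboolP [w [uw vw ew]] mink.
exists w; split=> // w' uw' vw'; have [l el] := on_gamma_chi uw'.
rewrite /gr ler_pM2l // ew el lerD2l lerN2 ler_nat mink //.
by apply/asboolP; exists w'.
Qed.

Lemma truncn_gr v w : on_gamma v w ->
  gr v - 2 * (Num.truncn ((gr v - gr w) / 2))%:R = gr w.
Proof.
move=> /on_gamma_chi [k ek]; rewrite /gr ek.
have -> : (2 * chi v - 2 * (chi v - k%:R)) / 2 = k%:R :> rat by lra.
by rewrite natrK; lra.
Qed.

End GradedRoot.

Record sym_root := SymRoot {
  sroot :> graded_root;
  J : sroot -> sroot;
  J_involutive : involutive J;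
  J_edge : forall u v, edge (J u) (J v) = edge u v;
  J_chi : forall v, chi (J v) = chi v;
  J_fixed : forall u v, J u = u -> J v = v -> chi u = chi v -> u = v }.

Section Drawing.
Variables (R : sym_root) (x : R -> rat).
Implicit Types u v : R.

(* The vertex v is placed at the point (x v, chi v) and edges are straight
   segments.  An edge joins consecutive levels, so two edges can only cross when
   they join the same two levels.  J is the reflection in the axis x = 0. *)
Definition symmetric_drawing :=
  [/\ forall u v, chi u = chi v -> x u = x v -> u = v,
      forall u u' v v', edge u u' -> edge v v' ->
        chi u = chi v -> chi u' = chi v' -> x u < x v -> x u' <= x v' &
      forall v, x (J v) = - x v].

(* Leaves at different levels are compared through the paths descending from
   them, at a level where these paths are distinct. *)
Definition left_of u v := exists u' v',
  [/\ on_gamma u u', on_gamma v v', chi u' = chi v' & x u' < x v'].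

Definition leaves_left_to_right (s : seq R) :=
  [/\ uniq s, forall v, v \in s <-> leaf v &
      pairwise (fun u v => `[< left_of u v >]) s].

End Drawing.

(* When the number of leaves is odd, the middle one is repeated.  The generator
   alpha between the two copies then has degree gr v + 1 and its boundary is the
   sum of the two copies, as the convention requires. *)
Definition double_middle (T : Type) (s : seq T) :=
  if odd (size s) then take (size s)./2.+1 s ++ drop (size s)./2 s else s.

Lemma lin_ext_homog (I J : finType) (dI : I -> rat) (dJ : J -> rat)
    (c : rat) (f : I -> free_mod J) :
  (forall i, homog dJ (dI i + c) (f i)) ->
  forall q x, homog dI q x -> homog dJ (q + c) (lin_ext f x).
Proof.
move=> hf q x hx j k; rewrite /lin_ext sum_ffunE coef_sum.
have [/existsP [i] | /existsPn no] :=
  boolP [exists i, ((x i : FU) * (f i j : FU))`_k != 0]; last first.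
  rewrite big1 ?eqxx // => i _; rewrite ffunE; apply/eqP.
  by move: (no i); rewrite negbK.
move=> nz _; move: nz; rewrite coefM.
have [/existsP [a] | /existsPn no] :=
  boolP [exists a : 'I_k.+1, (x i : FU)`_a * (f i j : FU)`_(k - a) != 0];
  last by rewrite big1 ?eqxx // => a _; apply/eqP; move: (no a); rewrite negbK.
rewrite mulf_eq0 negb_or => /andP [/hx ea /hf eb] _.
have -> : k%:R = a%:R + (k - a)%:R :> rat by rewrite -natrD subnKC // -ltnS.
lra.
Qed.

Lemma lin_ext_basis (I J : finType) (f : I -> free_mod J) i :
  lin_ext f (basis_vec i) = f i.
Proof.
rewrite /lin_ext (bigD1 i) //= big1 => [|j ne]; rewrite ffunE.
  by rewrite eqxx scale1r addr0.
by rewrite (negPf ne) scale0r.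
Qed.

Lemma homog_monomial (I : finType) (deg : I -> rat) i n :
  homog deg (deg i - 2 * n%:R) ('X^n *: basis_vec i).
Proof.
move=> j k; rewrite !ffunE /=; case: (j =P i) => [->|_].
  rewrite /GRing.scale /= mulr1 coefXn; case: (k =P n) => [-> //|_].
  by rewrite eqxx.
by rewrite scaler0 coef0 eqxx.
Qed.

Lemma homogD (I : finType) (deg : I -> rat) q (x y : free_mod I) :
  homog deg q x -> homog deg q y -> homog deg q (x + y).
Proof.
move=> hx hy i k; rewrite ffunE coefD.
by have [-> | /hx //] := eqVneq ((x i : FU)`_k) 0; rewrite add0r => /hy.
Qed.

Section StandardComplex.
Variables (R : graded_root) (s : seq R).

Definition vertex (i : 'I_(size s)) : R := tnth (in_tuple s) i.

Lemma lt_next (i : 'I_(size s).-1) : (i.+1 < size s)%N.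
Proof. by case: (size s) i => [|n] [i]. Qed.

Definition ord_left (i : 'I_(size s).-1) : 'I_(size s) :=
  widen_ord (leq_pred _) i.
Definition ord_right (i : 'I_(size s).-1) : 'I_(size s) := Ordinal (lt_next i).

(* inl i is the generator v_i and inr i is the generator alpha_i. *)
Definition std_gen : finType := ('I_(size s) + 'I_(size s).-1)%type.

Definition gr_alpha (i : 'I_(size s).-1) : rat :=
  gr (meet (vertex (ord_left i)) (vertex (ord_right i))).

Definition std_deg (a : std_gen) : rat :=
  match a with
  | inl i => gr (vertex i)
  | inr i => gr_alpha i + 1
  end.

Definition U_power (i : 'I_(size s).-1) (j : 'I_(size s)) : FU :=
  'X^(Num.truncn ((gr (vertex j) - gr_alpha i) / 2)).

Definition std_bd_gen (a : std_gen) : free_mod std_gen :=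
  match a with
  | inl _ => 0
  | inr i => U_power i (ord_left i) *: basis_vec (inl (ord_left i) : std_gen) +
             U_power i (ord_right i) *: basis_vec (inl (ord_right i) : std_gen)
  end.

Definition std_bd : {linear free_mod std_gen -> free_mod std_gen} :=
  lin_ext std_bd_gen.

Lemma std_bd_homog q x :
  homog std_deg q x -> homog std_deg (q - 1) (std_bd x).
Proof.
apply: lin_ext_homog => -[i|i] /=; first by move=> j k; rewrite ffunE coef0 eqxx.
have [ul ur _] := meetP (vertex (ord_left i)) (vertex (ord_right i)).
have hl := @homog_monomial _ std_deg (inl (ord_left i)).
have hr := @homog_monomial _ std_deg (inl (ord_right i)).
rewrite addrK; apply: homogD.
  by have := hl (Num.truncn ((gr (vertex (ord_left i)) - gr_alpha i) / 2));
    rewrite /= truncn_gr.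
by have := hr (Num.truncn ((gr (vertex (ord_right i)) - gr_alpha i) / 2));
  rewrite /= truncn_gr.
Qed.

Lemma std_bd_bd x : std_bd (std_bd x) = 0.
Proof.
transitivity (std_bd (\sum_a (x a : FU) *: std_bd_gen a)); first by [].
rewrite raddf_sum big1 // => -[i|i] _; rewrite /std_bd /= linearZ /=.
  by rewrite [lin_ext _ _]raddf0 scaler0.
by rewrite linearD !linearZ /= !lin_ext_basis /= !scaler0 addr0 scaler0.
Qed.

Definition std_complex := GComplex std_bd_homog std_bd_bd.

Definition std_rev (a : std_gen) : std_gen :=
  match a with
  | inl i => inl (rev_ord i)
  | inr i => inr (rev_ord i)
  end.

Definition std_J :
  {linear module_of std_complex -> module_of std_complex} :=
  lin_ext (fun a => basis_vec (std_rev a)).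

End StandardComplex.

Section MonotoneSubroot.
Variable R : sym_root.
Implicit Types (u v w : R) (b : rat) (S : seq R).

Definition stem v := J v = v.

Definition is_base v b :=
  (exists w, [/\ on_gamma v w, stem w & gr w = b]) /\
  (forall w, on_gamma v w -> stem w -> gr w <= b).

Definition cluster b v := is_base v b.

Definition nontrivial b := exists u v, [/\ cluster b u, cluster b v & u <> v].

(* The tips of the cluster C_b are then v and J v. *)
Definition is_tip b v :=
  [/\ leaf v, J v <> v, cluster b v, cluster b (J v) &
      forall u, cluster b u -> gr u <= gr v].

Definition add_tips (tip : rat -> R) S b :=
  if all (fun u => gr u < gr (tip b)) S then [:: tip b, J (tip b) & S] else S.

(* S is a set of leaves produced by the construction, for the choice of tips
   given by tip; bs lists the b < r for which C_b is nontrivial. *)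
Definition monotone_leaves S :=
  exists (top : R) (tip : rat -> R) (bs : seq rat), let r := gr top in
  [/\ stem top /\ (forall w, stem w -> gr w <= r),
      forall b, nontrivial b -> is_tip b (tip b),
      forall b, b \in bs <-> b < r /\ nontrivial b,
      sorted (fun b b' => b' < b) bs &
      S = foldl (add_tips tip)
            (if `[< nontrivial r >] then [:: tip r; J (tip r)] else [:: top]) bs].

End MonotoneSubroot.

(* M, embedded in R by f, is the union of the paths gamma_v for v in S, with the
   structure induced from R. *)
Definition subroot_spanned (R : sym_root) (S : seq R) (M : sym_root)
  (f : M -> R) :=
  [/\ injective f,
      forall w, (exists u, f u = w) <-> (exists2 v, v \in S & on_gamma v w),
      forall u v, edge (f u) (f v) = edge u v,
      forall u, chi (f u) = chi u &
      forall u, f (J u) = J (f u)].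

Definition monotone_subroot (R M : sym_root) :=
  exists S (f : M -> R), monotone_leaves S /\ subroot_spanned S f.

(* Main.v *)
From HB Require Import structures.
From mathcomp Require Import all_boot all_order all_algebra.
From mathcomp Require Import boolp classical_sets.
From mathcomp Require Import ring lra zify.
Require Import Defs.

(** A sequence of leaves with the degrees of the meets of consecutive entries
    determines the standard complex, and a map of leaves v_i |-> v'_(phi i)
    which lowers neither degrees nor meets of consecutive leaves extends to a
    chain map: v_i goes to the multiple of v'_(phi i) by the power of U that
    corrects the degree, and alpha_i goes to the sum of the alpha'_k between phi
    i and phi (i + 1), with the appropriate powers of U. The boundary of that
    sum telescopes in characteristic 2 ([bd_zigzag]). The powers of U exist as
    soon as each such alpha'_k has degree at least that of alpha_i; since leaves
    are listed from left to right, the degree of each such alpha'_k is at least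
    that of the meet of the two end leaves ([planar_list_of_drawing]). If phi
    commutes with the reflection, the chain map commutes with J on the nose
    ([leaf_map_local]), so that all homotopies can be taken to be 0.

    Both local maps have this form. From M to R one takes the inclusion of
    leaves. From R to M, a leaf v on the left is sent to a leaf h v that depends
    only on the base b of v, and the leaf J v on the right to J (h v). The
    construction of the monotone subroot ensures that some leaf of M has base at
    least b and degree at least that of every vertex of the cluster C_b
    ([dominating_leaf]): if the tips of C_b were not added, then a leaf added
    earlier is at least as high. Meets do not decrease: two leaves on the left
    in one cluster have the same image, two leaves in different clusters meet no
    higher than either of their bases ([cluster_meet]), the leaves v and J v
    meet at the base of v, and any two of the images meet at least as high as
    the lower of their bases ([reaches_meet]).

    The localized homology is controlled by the augmentation v_i |->
    U^((D-d_i)/2), alpha_i |-> 0, where d_i is the degree of v_i and D is an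
    upper bound of all degrees in their class mod 2: it induces an isomorphism
    from U^-1 H to F[U, U^-1] ([loc_aug]) that shifts degrees by D. With a
    common D for R and M, the chain maps above preserve augmentations, so they
    become isomorphisms after inverting U ([localized_map_bij]). *)

Set Implicit Arguments.
Unset Strict Implicit.
Unset Printing Implicit Defensive.

Import Order.TTheory GRing.Theory Num.Theory.
Local Open Scope ring_scope.

(** * Even differences of degrees and sums in characteristic 2 *)

(** A power of U carries degree p to degree q. *)
Definition even_le (q p : rat) := exists n : nat, p = q + 2 * n%:R.

(** The exponent of that power, written as in [U_power]. *)
Definition half_diff (p q : rat) : nat := Num.truncn ((p - q) / 2).

Lemma half_diffE q n : half_diff (q + 2 * n%:R) q = n.
Proof.
rewrite /half_diff; have -> : (q + 2 * n%:R - q) / 2 = n%:R :> rat by lra.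
exact: natrK.
Qed.

Lemma half_diffxx q : half_diff q q = 0%N.
Proof. by have := half_diffE q 0; rewrite mulr0 addr0. Qed.

Lemma half_diffK q p : even_le q p -> p - 2 * (half_diff p q)%:R = q.
Proof. by case=> n ->; rewrite half_diffE; lra. Qed.

Lemma half_diffD a b c :
  even_le a b -> even_le b c ->
  half_diff c a = (half_diff b a + half_diff c b)%N.
Proof.
move=> [m ->] [n ->]; rewrite !half_diffE -addrA -mulrDr -natrD.
by rewrite half_diffE.
Qed.

Lemma even_le_refl q : even_le q q.
Proof. by exists 0; lra. Qed.

Lemma even_le_trans a b c : even_le a b -> even_le b c -> even_le a c.
Proof. by move=> [m ->] [n ->]; exists (m + n)%N; rewrite natrD; lra. Qed.

Lemma addvv (V : lmodType FU) (v : V) : v + v = 0.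
Proof.
rewrite -mulr2n -scaler_nat.
suff -> : 2%:R = 0 :> FU by rewrite scale0r.
by rewrite -polyC_natr (_ : 2%:R = 0 :> 'F_2) //; apply/val_inj.
Qed.

Lemma basis_expand (I : finType) (x : free_mod I) :
  x = \sum_i (x i : FU) *: basis_vec i.
Proof.
apply/ffunP=> j; rewrite sum_ffunE (bigD1 j) //= big1 => [|i ne].
  by rewrite !ffunE eqxx addr0 /GRing.scale /= mulr1.
by rewrite !ffunE eq_sym (negPf ne) scaler0.
Qed.

Lemma eq_on_basis (I : finType) (V : lmodType FU)
    (f g : {linear free_mod I -> V}) :
  (forall i, f (basis_vec i) = g (basis_vec i)) -> f =1 g.
Proof.
move=> e x; rewrite [x]basis_expand !linear_sum; apply: eq_bigr => i _.
by rewrite !linearZ /= e.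
Qed.

(** The integer k separates p from q, in either order: for an index k of an
    alpha generator, this says that alpha_k lies on the segment of leaves from p
    to q. *)
Definition between (p q k : nat) := (p <= k)%N != (q <= k)%N.

Lemma telescope_between (V : lmodType FU) (B : nat -> V) n p q :
  (p <= n)%N -> (q <= n)%N ->
  \sum_(k < n | between p q k) (B k + B k.+1) = B p + B q.
Proof.
have oppB v : - v = v :> V by apply/eqP; rewrite eq_sym -addr_eq0 addvv.
wlog lepq : p q / (p <= q)%N => [th hp hq|_ hq].
  case: (leqP p q) => [/th|/ltnW/th]; first exact.
  rewrite [RHS]addrC => <- //; apply: eq_bigl => k.
  by rewrite /between eq_sym.
rewrite -(big_mkord (between p q) (fun k => B k + B k.+1)).
transitivity (\sum_(p <= k < q) (B k.+1 - B k)).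
  rewrite [RHS](big_nat_widen _ _ n) // [RHS](big_nat_widenl _ 0) //.
  apply: eq_big => [k|k _]; last by rewrite oppB addrC.
  by rewrite /between; lia.
by rewrite telescope_sumr // oppB addrC.
Qed.

(** * Localized homology through an augmentation *)

(** A chain map to F[U] (with zero differential) that shifts degrees by sigma and
    whose kernel and cokernel on homology are killed by powers of U. The last
    two fields are what makes it an isomorphism after inverting U. *)
Record augmentation (C : gcomplex) (sigma : rat) := Augmentation {
  aug :> {linear module_of C -> FU^o};
  aug_bd : forall x, aug (bd C x) = 0;
  aug_homog : forall q x, homog (@gdeg C) q x -> homog_poly (q - sigma) (aug x);
  aug_exact : forall x, bd C x = 0 -> aug x = 0 ->
    exists m y, bd C y = 'X^m *: x;
  aug_unit : exists e x, [/\ bd C x = 0, homog (@gdeg C) (sigma - 2 * e%:R) x &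
    aug x = 'X^e :> FU] }.

Section LocalizedHomology.
Variables (C : gcomplex) (sigma : rat) (a : augmentation C sigma).

Definition homology_aug (h : homology C) : FU^o := a (cycle_val (repr h)).

Lemma homology_augE z : homology_aug (hclass z) = a (cycle_val z).
Proof.
have /hclassP [y e] := hclassK (hclass z); apply/eqP.
rewrite /homology_aug -subr_eq0 -raddfB; apply/eqP.
by rewrite -[RHS](aug_bd a y); congr (aug a _); rewrite e.
Qed.

Lemma homology_aug_is_linear : linear homology_aug.
Proof.
move=> p g h; rewrite -(hclassK g) -(hclassK h).
have -> : p *: hclass (repr g) = hclass (p *: repr g) by exact: scale_hclass.
by rewrite -hclassD !homology_augE linearP.
Qed.

HB.instance Definition _ := GRing.isLinear.Build FU (homology C) FU^o *:%R
  homology_aug homology_aug_is_linear.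

Definition loc_aug (x : localized_homology C) : Laurent :=
  loc_map homology_aug x.

Lemma loc_augE h k : loc_aug (frac h k) = frac (homology_aug h) k.
Proof.
have /fracP [m e] := fracK (frac h k); apply/fracP; exists m.
by rewrite -!linearZ e.
Qed.

Lemma loc_aug_is_linear : linear loc_aug.
Proof.
move=> p x y; rewrite -(fracK x) -(fracK y).
rewrite [p *: frac _ _]scale_frac [_ + _]add_frac !loc_augE.
rewrite [p *: frac _ _]scale_frac [RHS]add_frac.
congr frac; rewrite linearD; congr (_ + _); last by rewrite linearZ.
rewrite linearZ; congr (_ *: _); by rewrite linearZ.
Qed.

HB.instance Definition _ := GRing.isLinear.Build FU (localized_homology C)
  Laurent *:%R loc_aug loc_aug_is_linear.

Lemma loc_aug_inj : injective loc_aug.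
Proof.
apply: raddf_inj => x; rewrite -(fracK x) -[LHS]/(loc_aug _) loc_augE.
move=> /fracP [m].
set h := loc_num x; rewrite !scaler0 addn0 -(hclassK h) homology_augE => e0.
pose z := 'X^m *: repr h.
have ez : a (cycle_val z) = 0 by rewrite linearZ.
have cz : bd C (cycle_val z) = 0 by case: (z) => v /= /eqP.
have [n [y ey]] := aug_exact cz ez.
apply/fracP; exists (n + m)%N; rewrite !scaler0 addn0.
rewrite exprD -scalerA.
have scE (p : FU) w : p *: hclass w = hclass (p *: w) := scale_hclass p w.
rewrite !scE; have -> : 0 = hclass (0 : cycle C) by rewrite /hclass raddf0.
by apply/hclassP; exists y; rewrite subr0 hclassK ey.
Qed.

Lemma aug_unit_class : exists e z,
  homog (@gdeg C) (sigma - 2 * e%:R) (cycle_val z) /\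
  homology_aug (hclass z) = 'X^e :> FU.
Proof.
have [e [x [cx hx ax]]] := aug_unit a.
have cyx : x \in @cycles C by rewrite inE cx.
by exists e, (Cycle cyx); rewrite homology_augE.
Qed.

(** Division by U^e makes the class z, of augmentation U^e, a generator. *)
Lemma loc_aug_lift e z (p : FU) k : homology_aug (hclass z) = 'X^e :> FU ->
  loc_aug (frac (p *: hclass z) (k + e)) = frac (p : FU^o) k.
Proof.
move=> ez; rewrite loc_augE.
have -> : homology_aug (p *: hclass z) = p *: homology_aug (hclass z).
  by rewrite linearZ.
rewrite ez; apply/fracP; exists 0.
rewrite !add0n /GRing.scale /= exprD; ring.
Qed.

Lemma loc_aug_bij : bijective loc_aug.
Proof.
have [e [z [_ ez]]] := aug_unit_class.
pose g (x : Laurent) : localized_homology C :=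
  frac ((loc_num x : FU) *: hclass z) (loc_den x + e).
have fgK : cancel g loc_aug.
  by move=> x; rewrite loc_aug_lift // fracK.
by exists g => // x; apply: loc_aug_inj; rewrite fgK.
Qed.

Lemma loc_aug_homog q x : loc_homog (@homology_homog C) q x <->
  loc_homog homog_poly (q - sigma) (loc_aug x).
Proof.
split=> [[h [k [[z hz ->] ->]]]|[p [k [hp ep]]]].
  exists (homology_aug (hclass z)), k; split; last exact: loc_augE.
  by rewrite homology_augE addrAC; apply: aug_homog.
have [e [z [hz ez]]] := aug_unit_class.
exists (p *: hclass z), (k + e)%N; split.
  exists (p *: z); last by rewrite [LHS]scale_hclass.
  move=> i n; rewrite ffunE /GRing.scale /= coefM => nz.
  have [j nzj] : exists j : 'I_n.+1,
      (p : FU)`_j * (cycle_val z i : FU)`_(n - j) != 0.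
    apply/existsP; apply: contraNT nz => /existsPn no; rewrite big1 // => j _.
    by apply/eqP; move: (no j); rewrite negbK.
  move: nzj; rewrite mulf_eq0 negb_or => /andP [/hp e1 /hz e2].
  have -> : n%:R = j%:R + (n - j)%:R :> rat by rewrite -natrD subnKC // -ltnS.
  by rewrite natrD; lra.
by apply: loc_aug_inj; rewrite ep loc_aug_lift.
Qed.

End LocalizedHomology.

(** Through the augmentations, both localized homologies become F[U, U^-1], and
    the map induced by f becomes the identity. *)
Lemma localized_map_bij (C D : gcomplex) (sigma : rat)
    (aC : augmentation C sigma) (aD : augmentation D sigma)
    (f : {linear module_of C -> module_of D}) :
  (forall x, f (bd C x) = bd D (f x)) -> (forall x, aD (f x) = aC x) ->
  bijective (localized_homology_map f).
Proof.
move=> fbd fa.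
have e : loc_aug aD \o localized_homology_map f =1 loc_aug aC.
  move=> x; rewrite /= /localized_homology_map /loc_map loc_augE /loc_aug.
  congr frac; rewrite /homology_map homology_augE insubdK ?fa //.
  rewrite inE -fbd; case: (repr _) => v /= /eqP ->.
  by rewrite raddf0.
have [g gK Kg] := loc_aug_bij aD.
apply: (eq_bij (f := g \o loc_aug aC)).
  apply: bij_comp (loc_aug_bij aC).
  by exists (loc_aug aD).
by move=> x; rewrite /= -e /= gK.
Qed.

(** * The homology of a standard complex *)

Section Zigzag.
Variables (R : graded_root) (s : seq R).
Local Notation v := (vertex (s := s)).
Local Notation left := (ord_left (s := s)).
Local Notation right := (ord_right (s := s)).

Lemma even_le_gamma (u w : R) : on_gamma u w -> even_le (gr w) (gr u).
Proof.
by move=> /on_gamma_chi [k ek]; exists k; rewrite /gr ek; lra.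
Qed.

Lemma alpha_left k : even_le (gr_alpha k) (gr (v (left k))).
Proof. by apply: even_le_gamma; case: (meetP (v (left k)) (v (right k))). Qed.

Lemma alpha_right k : even_le (gr_alpha k) (gr (v (right k))).
Proof. by apply: even_le_gamma; case: (meetP (v (left k)) (v (right k))). Qed.

(** The multiple U^n v_k of degree A, for k below the number of leaves. Indexing
    by natural numbers makes the boundaries of the alpha_k telescope. *)
Definition leaf_at (A : rat) (k : nat) : module_of (std_complex s) :=
  oapp (fun i => 'X^(half_diff (gr (v i)) A) *: basis_vec (inl i : std_gen s))
    0 (insub k).

Lemma leaf_atE A (i : 'I_(size s)) :
  leaf_at A i = 'X^(half_diff (gr (v i)) A) *: basis_vec (inl i : std_gen s).
Proof. by rewrite /leaf_at valK. Qed.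

(** The chain of degree A + 1 running along the leaves from p to q. *)
Definition zigzag (A : rat) (p q : nat) : module_of (std_complex s) :=
  \sum_(k < (size s).-1 | between p q k)
    'X^(half_diff (gr_alpha k) A) *: basis_vec (inr k : std_gen s).

(** In degree A, the boundary of alpha_k is v_k + v_(k+1) up to powers of U, and
    each interior leaf of the zigzag occurs twice. *)
Lemma bd_zigzag A (p q : 'I_(size s)) :
  (forall k : 'I_(size s).-1, between p q k -> even_le A (gr_alpha k)) ->
  std_bd s (zigzag A p q) = leaf_at A p + leaf_at A q.
Proof.
move=> hA; rewrite linear_sum -(@telescope_between _ (leaf_at A) (size s).-1);
  try by have := ltn_ord p; have := ltn_ord q; lia.
apply: eq_bigr => k /hA leA; rewrite linearZ /= lin_ext_basis /= scalerDr.
rewrite (leaf_atE A (left k)) (leaf_atE A (right k)) !scalerA /U_power.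
by rewrite -!exprD (half_diffD leA (alpha_left k))
  (half_diffD leA (alpha_right k)).
Qed.

Lemma zigzag_homog A p q :
  (forall k : 'I_(size s).-1, between p q k -> even_le A (gr_alpha k)) ->
  homog (@std_deg _ s) (A + 1) (zigzag A p q).
Proof.
move=> hA; rewrite /zigzag; elim/big_ind: _ => [i k||k /hA leA].
- by rewrite ffunE coef0 eqxx.
- by move=> x y; apply: homogD.
have -> : A + 1 = @std_deg _ s (inr k) - 2 * (half_diff (gr_alpha k) A)%:R.
  by rewrite /= addrAC (half_diffK leA).
exact: homog_monomial.
Qed.

Section Augmentation.
Variables (D : rat) (leD : forall i, even_le (gr (v i)) D).

(** For the full predicate this is the augmentation. Its restrictions to initial
    segments of leaves serve to isolate single alpha generators. *)
Definition leaf_sum (P : pred 'I_(size s)) (x : module_of (std_complex s)) :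
    FU^o :=
  \sum_(i | P i) ('X^(half_diff D (gr (v i))) : FU) *: x (inl i : std_gen s).

Lemma leaf_sum_is_linear P : linear (leaf_sum P).
Proof.
move=> a x y; rewrite /leaf_sum scaler_sumr -big_split /=.
apply: eq_bigr => i _.
by rewrite !ffunE scalerDr !scalerA mulrC.
Qed.

HB.instance Definition _ P := GRing.isLinear.Build FU
  (module_of (std_complex s)) FU^o *:%R (leaf_sum P) (leaf_sum_is_linear P).

Lemma leaf_sumD P (a b : FU) x y :
  leaf_sum P (a *: x + b *: y) = a *: leaf_sum P x + b *: leaf_sum P y.
Proof. by rewrite linearD !linearZ. Qed.

Lemma leaf_sum_inl P i : leaf_sum P (basis_vec (inl i : std_gen s)) =
  (P i)%:R *: ('X^(half_diff D (gr (v i))) : FU^o).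
Proof.
rewrite /leaf_sum big_mkcond (bigD1 i) //= big1 => [|j ne].
  by rewrite addr0 ffunE eqxx; case: (P i); rewrite ?scale1r ?scale0r //
    /GRing.scale /= mulr1.
by rewrite ffunE (inj_eq (@inl_inj _ _)) (negPf ne) scaler0 if_same.
Qed.

Lemma leaf_sum_inr P k : leaf_sum P (basis_vec (inr k : std_gen s)) = 0.
Proof. by rewrite /leaf_sum big1 // => i _; rewrite ffunE scaler0. Qed.

Lemma leaf_sum_bd P k : leaf_sum P (std_bd_gen (inr k : std_gen s)) =
  (P (left k))%:R *: ('X^(half_diff D (gr_alpha k)) : FU^o) +
  (P (right k))%:R *: ('X^(half_diff D (gr_alpha k)) : FU^o).
Proof.
rewrite /= leaf_sumD !leaf_sum_inl /U_power.
rewrite !scalerA ![_ * (P _)%:R]mulrC -!scalerA.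
congr (_ *: _ + _ *: _); rewrite /GRing.scale /= -exprD addnC.
  by rewrite (half_diffD (alpha_left k) (leD _)) addnC.
by rewrite (half_diffD (alpha_right k) (leD _)) addnC.
Qed.

Lemma leaf_sum_all_bd x : leaf_sum predT (std_bd s x) = 0.
Proof.
suff /(_ x) : leaf_sum predT \o std_bd s =1 \0 by [].
apply: eq_on_basis => -[i|k] /=; rewrite lin_ext_basis ?linear0 //.
by rewrite leaf_sum_bd /= addvv.
Qed.

(** The sum over the leaves up to the left end of alpha_k kills every boundary
    of a generator except that of alpha_k: all other alpha generators have both
    ends or no end in that segment. *)
Lemma cycle_inr x k : std_bd s x = 0 -> x (inr k : std_gen s) = 0.
Proof.
move=> cx; pose P (i : 'I_(size s)) := (i <= k)%N.
have ok y : leaf_sum P (std_bd s y) =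
    ('X^(half_diff D (gr_alpha k)) : FU) *: y (inr k : std_gen s).
  pose c (y : module_of (std_complex s)) : FU^o :=
    ('X^(half_diff D (gr_alpha k)) : FU) *: y (inr k : std_gen s).
  have lc : linear c.
    by move=> a u w; rewrite /c !ffunE scalerDr !scalerA mulrC.
  pose cL := GRing.isLinear.Build FU (module_of (std_complex s)) FU^o *:%R c lc.
  pose C : {linear module_of (std_complex s) -> FU^o} := HB.pack c cL.
  suff /(_ y) : leaf_sum P \o std_bd s =1 C by [].
  apply: eq_on_basis => -[i|j] /=; rewrite lin_ext_basis ?linear0.
    by rewrite /c ffunE scaler0.
  rewrite leaf_sum_bd /c ffunE (inj_eq (@inr_inj _ _)) /P /=.
  have [->|ne] := eqVneq k j.
    by rewrite leqnn ltnn scale1r scale0r addr0 /GRing.scale /= mulr1.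
  rewrite scaler0 (_ : (j < k)%N = (j <= k)%N) ?addvv //.
  by rewrite [RHS]leq_eqVlt (inj_eq val_inj) eq_sym (negPf ne).
have := ok x; rewrite cx linear0 => /esym/eqP.
rewrite /GRing.scale /= mulf_eq0 expf_eq0 polyX_eq0 andbF => /eqP.
exact.
Qed.

Lemma leaf_sum_homog q x : homog (@std_deg _ s) q x ->
  homog_poly (q - D) (leaf_sum predT x).
Proof.
move=> hx k; rewrite coef_sum => nz.
have [i nzi] : exists i : 'I_(size s),
    ('X^(half_diff D (gr (v i))) *: x (inl i : std_gen s) : FU)`_k != 0.
  apply/existsP; apply: contraNT nz => /existsPn no; rewrite big1 // => i _.
  by apply/eqP; move: (no i); rewrite negbK.
move: nzi; rewrite /GRing.scale /= coefXnM.
case: ltnP => [_|lek]; first by rewrite eqxx.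
move=> /hx /= e; have := half_diffK (leD i); rewrite natrB // in e; lra.
Qed.

(** After multiplication by a power of U, each v_i becomes homologous, along a
    zigzag, to a multiple of the first leaf; the total multiple is the
    augmentation, which vanishes. *)
Lemma leaf_sum_exact x : (0 < size s)%N ->
  std_bd s x = 0 -> leaf_sum predT x = 0 ->
  exists m y, std_bd s y = 'X^m *: x.
Proof.
move=> s_gt0 cx ax; pose o := Ordinal s_gt0.
(* A is a common even lower bound for the degrees of all leaves and meets. *)
pose n k := half_diff D (@gr_alpha _ s k).
pose m i := half_diff D (gr (v i)).
pose A := D - 2 * (\sum_k n k + \sum_i m i)%:R.
have leA (k : 'I_(size s).-1) : even_le A (gr_alpha k).
  exists (\sum_(j | j != k) n j + \sum_i m i)%N.
  rewrite /A (bigD1 k) //= !natrD.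
  have := half_diffK (even_le_trans (alpha_left k) (leD _)).
  by rewrite -/(n k); lra.
have leAv (i : 'I_(size s)) : even_le A (gr (v i)).
  exists (\sum_k n k + \sum_(j | j != i) m j)%N.
  rewrite /A (bigD1 i) //= !natrD.
  have := half_diffK (leD i); rewrite -/(m i); lra.
exists (half_diff D A).
exists (\sum_i ('X^(half_diff D (gr (v i))) * x (inl i : std_gen s) : FU) *:
   zigzag A i o).
transitivity (\sum_i (('X^(half_diff D A) * x (inl i : std_gen s) : FU) *:
    basis_vec (inl i : std_gen s) +
  ('X^(half_diff D (gr (v i))) * x (inl i : std_gen s) : FU) *: leaf_at A o)).
  rewrite linear_sum; apply: eq_bigr => i _.
  transitivity (('X^(half_diff D (gr (v i))) * x (inl i : std_gen s) : FU) *: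
    std_bd s (zigzag A i o)); first by rewrite linearZ.
  rewrite bd_zigzag // scalerDr leaf_atE !scalerA mulrAC -exprD addnC.
  by rewrite -(half_diffD (leAv i) (leD i)).
rewrite big_split /= -scaler_suml -/(leaf_sum predT x) ax scale0r addr0.
rewrite [in RHS](basis_expand x) scaler_sumr big_sumType /=.
rewrite [X in _ + X]big1 => [|k _].
  by rewrite addr0; apply: eq_bigr => i _; rewrite scalerA.
by rewrite cycle_inr // scale0r scaler0.
Qed.


End Augmentation.
End Zigzag.

(** * Chain maps induced by maps of leaves *)

Section StandardAugmentation.
Variables (R : graded_root) (s : seq R) (D : rat).
Hypotheses (s_gt0 : (0 < size s)%N).
Hypothesis leD : forall i : 'I_(size s), even_le (gr (vertex i)) D.

Lemma leaf_sum_unit : exists e (x : module_of (std_complex s)),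
  [/\ std_bd s x = 0, homog (@std_deg _ s) (D - 2 * e%:R) x &
      leaf_sum D predT x = 'X^e :> FU].
Proof.
pose o := Ordinal s_gt0; exists (half_diff D (gr (vertex o))).
exists (basis_vec (inl o : std_gen s)); split.
- by rewrite /= lin_ext_basis.
- have := @homog_monomial _ (@std_deg _ s) (inl o) 0.
  by rewrite expr0 scale1r mulr0 subr0 (half_diffK (leD o)).
by rewrite leaf_sum_inl scale1r.
Qed.

Definition std_augmentation : augmentation (std_complex s) D :=
  @Augmentation (std_complex s) D (leaf_sum D predT)
    (leaf_sum_all_bd leD) (leaf_sum_homog leD)
    (fun x => leaf_sum_exact leD s_gt0 (x := x)) leaf_sum_unit.

End StandardAugmentation.

Section LeafMap.
Variables (R R' : graded_root) (s : seq R) (t : seq R').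
Variable phi : 'I_(size s) -> 'I_(size t).

(** The second condition provides the powers of U in the zigzag from phi i to
    phi (i + 1) of degree gr_alpha i + 1. *)
Definition leaf_morphism :=
  (forall i, even_le (gr (vertex i)) (gr (vertex (phi i)))) /\
  (forall (i : 'I_(size s).-1) (k : 'I_(size t).-1),
    between (phi (ord_left i)) (phi (ord_right i)) k ->
    even_le (gr_alpha i) (gr_alpha k)).

Definition leaf_map_gen (a : std_gen s) : module_of (std_complex t) :=
  match a with
  | inl i => 'X^(half_diff (gr (vertex (phi i))) (gr (vertex i))) *:
               basis_vec (inl (phi i) : std_gen t)
  | inr i => zigzag t (gr_alpha i) (phi (ord_left i)) (phi (ord_right i))
  end.

Definition leaf_map :
    {linear module_of (std_complex s) -> module_of (std_complex t)} :=
  lin_ext leaf_map_gen.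

Hypothesis phiP : leaf_morphism.

Lemma leaf_map_bd x : leaf_map (std_bd s x) = std_bd t (leaf_map x).
Proof.
suff /(_ x) : leaf_map \o std_bd s =1 std_bd t \o leaf_map by [].
have [le_gr le_alpha] := phiP.
apply: eq_on_basis => -[i|i]; rewrite /= !lin_ext_basis.
  by rewrite [LHS]linear0 [RHS]linearZ /= lin_ext_basis scaler0.
rewrite [RHS]bd_zigzag; last exact: le_alpha.
transitivity (U_power i (ord_left i) *: leaf_map_gen (inl (ord_left i)) +
  U_power i (ord_right i) *: leaf_map_gen (inl (ord_right i))).
  rewrite [LHS]linearD.
  by congr (_ + _); rewrite [LHS]linearZ; congr (_ *: _); apply: lin_ext_basis.
rewrite !leaf_atE /= !scalerA -!exprD.
rewrite (half_diffD (alpha_left i) (le_gr _)).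
by rewrite (half_diffD (alpha_right i) (le_gr _)).
Qed.

Lemma leaf_map_homog q x :
  homog (@std_deg _ s) q x -> homog (@std_deg _ t) q (leaf_map x).
Proof.
have [le_gr le_alpha] := phiP.
rewrite -[q in homog (@std_deg _ t) q]addr0.
apply: lin_ext_homog => -[i|i]; rewrite /= addr0.
  have := @homog_monomial _ (@std_deg _ t) (inl (phi i))
    (half_diff (gr (vertex (phi i))) (gr (vertex i))).
  by rewrite /= (half_diffK (le_gr i)).
by apply: zigzag_homog; apply: le_alpha.
Qed.

Lemma leaf_map_chain :
  graded_chain_map (C := std_complex s) (D := std_complex t) leaf_map.
Proof. by split; [apply: leaf_map_bd | apply: leaf_map_homog]. Qed.

Lemma leaf_map_sum D x : (forall i : 'I_(size t), even_le (gr (vertex i)) D) ->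
  leaf_sum D predT (leaf_map x) = leaf_sum D predT x.
Proof.
move=> leD; have [le_gr le_alpha] := phiP.
suff /(_ x) : leaf_sum D predT \o leaf_map =1 leaf_sum D predT by [].
apply: eq_on_basis => -[i|i]; rewrite /= lin_ext_basis /=.
  transitivity ('X^(half_diff (gr (vertex (phi i))) (gr (vertex i))) *:
      leaf_sum D predT (basis_vec (inl (phi i) : std_gen t)));
    first by rewrite linearZ.
  rewrite !leaf_sum_inl !scale1r /GRing.scale /= -exprD.
  by rewrite -(half_diffD (le_gr i) (leD _)).
rewrite leaf_sum_inr raddf_sum big1 // => k _.
transitivity ('X^(half_diff (gr_alpha k) (gr_alpha i)) *:
      leaf_sum D predT (basis_vec (inr k : std_gen t)));
  first by exact: linearZ.
by rewrite leaf_sum_inr scaler0.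
Qed.

End LeafMap.

(** What is left of the symmetry of the root once only degrees are recorded. *)
Definition symmetric_list (R : graded_root) (s : seq R) :=
  (forall i : 'I_(size s), gr (vertex (rev_ord i)) = gr (vertex i)) /\
  (forall k : 'I_(size s).-1, gr_alpha (rev_ord k) = gr_alpha k).

Section Reversal.
Variables (R : graded_root) (s : seq R).

Lemma ord_left_rev (i : 'I_(size s).-1) :
  ord_left (rev_ord i) = rev_ord (ord_right i).
Proof. by apply: val_inj => /=; have := ltn_ord i; lia. Qed.

Lemma ord_right_rev (i : 'I_(size s).-1) :
  ord_right (rev_ord i) = rev_ord (ord_left i).
Proof. by apply: val_inj => /=; have := ltn_ord i; lia. Qed.

Lemma std_J_involutive x : std_J s (std_J s x) = x.
Proof.
suff /(_ x) : std_J s \o std_J s =1 idfun by [].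
by apply: eq_on_basis => -[i|i] /=; rewrite !lin_ext_basis /= rev_ordK.
Qed.

Hypothesis sym_s : symmetric_list s.

Lemma zigzag_rev A (p q : 'I_(size s)) :
  std_J s (zigzag s A p q) = zigzag s A (rev_ord q) (rev_ord p).
Proof.
rewrite linear_sum [RHS](reindex_inj rev_ord_inj) /=.
apply: eq_big => [k|k _]; last by rewrite linearZ /= lin_ext_basis sym_s.2.
rewrite /between /=; have := ltn_ord k; have := ltn_ord p; have := ltn_ord q.
by lia.
Qed.

Lemma std_J_morphism : leaf_morphism (@rev_ord (size s)).
Proof.
split=> [i|i k]; first by rewrite sym_s.1; apply: even_le_refl.
rewrite /between /= => ik; suff -> : k = rev_ord i.
  by rewrite sym_s.2; apply: even_le_refl.
by apply: val_inj => /=; have := ltn_ord k; have := ltn_ord i; lia.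
Qed.

(** The involution is itself induced by a map of leaves, which makes it a graded
    chain map: a zigzag between neighbours is a single alpha generator. *)
Lemma std_JE : std_J s =1 leaf_map (@rev_ord (size s)).
Proof.
apply: eq_on_basis => -[i|i]; rewrite /= !lin_ext_basis /=.
  by rewrite sym_s.1 half_diffxx expr0 scale1r.
rewrite /zigzag (big_pred1 (rev_ord i)) => [|k].
  by rewrite sym_s.2 half_diffxx expr0 scale1r.
rewrite /between /= -val_eqE /=; have := ltn_ord k; have := ltn_ord i; lia.
Qed.

Lemma std_J_chain :
  graded_chain_map (C := std_complex s) (D := std_complex s) (std_J s).
Proof.
have [bdJ homJ] := leaf_map_chain std_J_morphism.
by split=> [x|q x hx]; rewrite !std_JE; [apply: bdJ | apply: homJ].
Qed.

End Reversal.

Lemma chain_homotopic_eq (C D : gcomplex) (f g : module_of C -> module_of D) :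
  f =1 g -> chain_homotopic f g.
Proof.
move=> fg; exists \0; split=> [q x _ i k|x]; first by rewrite ffunE coef0 eqxx.
by rewrite fg subrr raddf0 addr0.
Qed.

Lemma std_iota_complex (R : graded_root) (s : seq R) (D : rat) :
  (0 < size s)%N -> (forall i : 'I_(size s), even_le (gr (vertex i)) D) ->
  symmetric_list s -> iota_complex (std_J s).
Proof.
move=> s_gt0 leD sym_s; split; last split.
- exists D; split.
    have int2 (n : nat) (c : int) : - (2 * n%:R) + c%:~R \is a @Num.int rat.
      by apply/intrP; exists (c - 2 * n%:Z); rewrite rmorphB rmorphM /=; lra.
    move=> [i|i] /=.
      have [n e] := leD i; have := int2 n 0; congr (_ \is a _); rewrite e; lra.
    have [n e] := even_le_trans (alpha_left i) (leD _).
    by have := int2 n 1; congr (_ \is a _); rewrite e; lra.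
  exists D, (loc_aug (std_augmentation s_gt0 leD)); split.
  - by exists 0; rewrite subrr mulr0.
  - exact: loc_aug_bij.
  exact: loc_aug_homog.
- exact: std_J_chain.
by apply: chain_homotopic_eq => x; apply: std_J_involutive.
Qed.

Lemma leaf_map_local (R R' : graded_root) (s : seq R) (t : seq R') (D : rat)
    (phi : 'I_(size s) -> 'I_(size t)) :
  (0 < size s)%N -> (0 < size t)%N ->
  (forall i : 'I_(size s), even_le (gr (vertex i)) D) ->
  (forall i : 'I_(size t), even_le (gr (vertex i)) D) ->
  symmetric_list s -> symmetric_list t ->
  leaf_morphism phi -> (forall i, phi (rev_ord i) = rev_ord (phi i)) ->
  local_map (std_J s) (std_J t) (leaf_map phi).
Proof.
move=> s_gt0 t_gt0 sD tD sym_s sym_t phiP phi_rev; split.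
- exact: leaf_map_chain.
- apply: chain_homotopic_eq; apply: eq_on_basis => -[i|i];
    rewrite /= !lin_ext_basis /=.
    rewrite [RHS]linearZ /= lin_ext_basis /= phi_rev.
    by rewrite sym_s.1 sym_t.1.
  rewrite [RHS]zigzag_rev // ord_left_rev ord_right_rev !phi_rev.
  by rewrite sym_s.2.
apply: (localized_map_bij (aC := std_augmentation s_gt0 sD)
  (aD := std_augmentation t_gt0 tD)); first exact: leaf_map_bd.
by move=> x; apply: leaf_map_sum.
Qed.

(** * Descending paths in a graded root *)

Section Descent.
Variable R : graded_root.
Implicit Types u v w : R.

(** The edge condition on a graded root leaves room for only one lower
    neighbour, so the paths gamma_v are the orbits of a function. *)
Definition down v : R := xget v [set w | edge v w /\ chi w < chi v]%classic.

Lemma downP v : edge v (down v) /\ chi (down v) < chi v.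
Proof.
rewrite /down; case: xgetP => [w -> //|no].
by have [w [e l]] := lower_neighbor v; case: (no w).
Qed.

Lemma down_unique v w : edge v w -> chi w < chi v -> w = down v.
Proof.
move=> evw ltw; have [e l] := downP v; apply/eqP; apply: contraT => ne.
by have := chi_max evw e ne; rewrite lt_max !ltNge (ltW ltw) (ltW l).
Qed.

Lemma chi_iter_down n v : chi (iter n down v) = chi v - n%:R.
Proof.
elim: n => [|n IHn]; first by rewrite subr0.
rewrite iterS -natr1 opprD addrA -IHn.
by have [e l] := downP (iter n down v); case: (chi_edge e) => ?; lra.
Qed.

Lemma on_gammaP v w : on_gamma v w <-> exists n, w = iter n down v.
Proof.
split=> [[g [rg <- [k <-]]]|[n ->]].
  exists k; elim: k => //= k <-.
  by have [e l] := rg k; apply: down_unique.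
exists (fun k => iter k down v); split=> // [k|]; last by exists n.
exact: downP.
Qed.

Lemma on_gamma_refl v : on_gamma v v.
Proof. by apply/on_gammaP; exists 0. Qed.

Lemma on_gamma_iter n v : on_gamma v (iter n down v).
Proof. by apply/on_gammaP; exists n. Qed.

Lemma on_gamma_trans u v w : on_gamma u v -> on_gamma v w -> on_gamma u w.
Proof.
move=> /on_gammaP [m ->] /on_gammaP [n ->]; apply/on_gammaP.
by exists (n + m)%N; rewrite iterD.
Qed.

Lemma on_gamma_le v w : on_gamma v w -> chi w <= chi v.
Proof. by move=> /on_gammaP [n ->]; rewrite chi_iter_down lerBlDr lerDl. Qed.

(** Descending paths are chains, so that the position on gamma_v is determined
    by the level. *)
Lemma on_gamma_linear v w w' :
  on_gamma v w -> on_gamma v w' -> chi w' <= chi w -> on_gamma w w'.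
Proof.
move=> /on_gammaP [m ->] /on_gammaP [n ->].
rewrite !chi_iter_down lerD2l lerN2 ler_nat => lemn.
by apply/on_gammaP; exists (n - m)%N; rewrite -iterD subnK.
Qed.

Lemma on_gamma_inj v w w' :
  on_gamma v w -> on_gamma v w' -> chi w = chi w' -> w = w'.
Proof.
move=> /on_gammaP [m ->] /on_gammaP [n ->]; rewrite !chi_iter_down.
by move=> /addrI /oppr_inj /eqP; rewrite eqr_nat => /eqP ->.
Qed.

Lemma on_gamma_level u v : chi u <= chi v ->
  exists2 w, on_gamma v w & chi w = chi u.
Proof.
move=> le_uv; have [m em] := intrP (chi_int v u).
exists (iter `|m|%N down v); first exact: on_gamma_iter.
have m0 : 0 <= m by rewrite -(ler0z rat) -em subr_ge0.
by rewrite chi_iter_down natr_absz ger0_norm // -em; lra.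
Qed.

Lemma le_gr_chi u v : (gr u <= gr v) = (chi u <= chi v).
Proof. by rewrite /gr ler_pM2l. Qed.

Lemma meet_geP q u v : q <= gr (meet u v) <->
  exists w, [/\ on_gamma u w, on_gamma v w & q <= gr w].
Proof.
have [um vm max] := meetP u v; split=> [le|[w [uw vw le]]].
  by exists (meet u v).
exact: le_trans le (max _ uw vw).
Qed.

Lemma gr_meetC u v : gr (meet u v) = gr (meet v u).
Proof.
apply/le_anti/andP; split; apply/meet_geP.
  by have [a b _] := meetP u v; exists (meet u v).
by have [a b _] := meetP v u; exists (meet v u).
Qed.

Lemma leaf_no_upper v w : leaf v -> edge v w -> w = down v.
Proof.
by move=> [w0 [_ u]] e; rewrite -(u _ e) (u _ (proj1 (downP v))).
Qed.

Lemma leaf_intro v : (forall w, edge v w -> w = down v) -> leaf v.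
Proof.
move=> h; exists (down v); split; first by case: (downP v).
by move=> w /h ->.
Qed.

(** All degrees of one root are congruent mod 2. *)
Lemma even_le_transfer q u v :
  even_le q (gr u) -> q <= gr v -> even_le q (gr v).
Proof.
move=> [n en]; have [m em] := intrP (chi_int v u) => le.
have evq : gr v = q + 2 * (m + n%:Z)%:~R.
  by rewrite rmorphD /= -em; move: en; rewrite /gr -pmulrn; lra.
have mn0 : 0 <= m + n%:Z by rewrite -(ler0z rat); lra.
by exists (absz (m + n%:Z)); rewrite natr_absz ger0_norm.
Qed.

End Descent.
Arguments down {R} v.

(** * The involution and planar drawings *)

Section Symmetry.
Variable R : sym_root.
Implicit Types u v w : R.

Lemma J_down v : J (down v) = down (J v).
Proof.
have [e l] := downP v; apply: down_unique; first by rewrite J_edge.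
by rewrite !J_chi.
Qed.

Lemma on_gammaJ v w : on_gamma v w -> on_gamma (J v) (J w).
Proof.
move=> /on_gammaP [n ->]; apply/on_gammaP; exists n.
by elim: n => //= n <-; rewrite J_down.
Qed.

Lemma gr_J v : gr (J v) = gr v.
Proof. by rewrite /gr J_chi. Qed.

Lemma gr_meetJ u v : gr (meet (J u) (J v)) = gr (meet u v).
Proof.
apply/le_anti/andP; split; apply/meet_geP.
  have [/on_gammaJ a /on_gammaJ b _] := meetP (J u) (J v).
  exists (J (meet (J u) (J v))); rewrite gr_J lexx.
  by rewrite !J_involutive in a b.
have [/on_gammaJ a /on_gammaJ b _] := meetP u v.
by exists (J (meet u v)); rewrite gr_J lexx.
Qed.

Lemma leaf_J v : leaf v -> leaf (J v).
Proof.
move=> lv; apply: leaf_intro => w e; rewrite -J_down -[w]J_involutive.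
congr J; apply: leaf_no_upper => //.
by rewrite -J_edge J_involutive.
Qed.

Lemma stem_gamma v w : stem v -> on_gamma v w -> stem w.
Proof.
move=> sv vw; apply: (on_gamma_inj (v := v)) => //; last by rewrite J_chi.
by have := on_gammaJ vw; rewrite sv.
Qed.

(** The image J w lies on gamma_v at the level of w, so it is w. *)
Lemma meet_J_stem v w : on_gamma v w -> on_gamma (J v) w -> stem w.
Proof.
move=> vw jw; apply: (on_gamma_inj (v := v)) => //; last by rewrite J_chi.
by have := on_gammaJ jw; rewrite J_involutive.
Qed.

Lemma stem_linear v w : stem v -> stem w -> chi w <= chi v -> on_gamma v w.
Proof.
move=> sv sw le_wv.
have [u vu eu] := on_gamma_level le_wv.
by rewrite -(J_fixed (stem_gamma sv vu) sw eu).
Qed.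

End Symmetry.

Section Planarity.
Variables (R : sym_root) (x : R -> rat).
Hypothesis hx : symmetric_drawing x.
Implicit Types u v w p q : R.

(** The absence of crossings, iterated downwards; the paths may merge, whence
    the weak inequality. *)
Lemma drawing_descend u v u' v' : chi u = chi v -> x u <= x v ->
  on_gamma u u' -> on_gamma v v' -> chi u' = chi v' -> x u' <= x v'.
Proof.
move=> euv le_x /on_gammaP [m ->] /on_gammaP [n ->]; rewrite !chi_iter_down euv.
move=> /addrI /oppr_inj /eqP; rewrite eqr_nat => /eqP ->.
have [x_inj x_mono _] := hx; elim: n => //= n; rewrite le_eqVlt.
move=> /orP [/eqP/x_inj -> //|]; first by rewrite !chi_iter_down euv.
have [e1 l1] := downP (iter n down u); have [e2 l2] := downP (iter n down v).
apply: x_mono => //; first by rewrite !chi_iter_down euv.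
by rewrite -!iterS !chi_iter_down euv.
Qed.

(** The two comparisons are made at different levels; the higher one is carried
    down to the lower one. *)
Lemma left_of_asym u v : left_of x u v -> ~ left_of x v u.
Proof.
move=> [u1 [v1 [uu1 vv1 e1 l1]]] [v2 [u2 [vv2 uu2 e2 l2]]].
have [le|/ltW le] := leP (chi u2) (chi u1).
  have := drawing_descend e1 (ltW l1) (on_gamma_linear uu1 uu2 le)
    (on_gamma_linear vv1 vv2 _) (esym e2).
  by rewrite -e1 e2 => /(_ le); rewrite leNgt l2.
have := drawing_descend e2 (ltW l2) (on_gamma_linear vv2 vv1 _)
  (on_gamma_linear uu2 uu1 le) (esym e1).
by rewrite -e1 e2 => /(_ le); rewrite leNgt l1.
Qed.

Definition weakly_left u v := left_of x u v \/ u = v.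

Lemma weakly_left_asym u v : weakly_left u v -> ~ left_of x v u.
Proof.
by case=> [uv|<-] vu; [exact: (left_of_asym uv vu)|exact: (left_of_asym vu vu)].
Qed.

(** Two paths that have merged at w enclose all leaves between them. At the
    level of w, the path from u could only pass on one side of w, and would then
    be on the wrong side of p or q; and u cannot lie below w, since p and q have
    the same path there and u would be on the same side of both. *)
Lemma on_gamma_between p u q w : weakly_left p u -> weakly_left u q ->
  on_gamma p w -> on_gamma q w -> on_gamma u w.
Proof.
move=> pu uq pw qw.
have nup := weakly_left_asym pu; have nqu := weakly_left_asym uq.
have [le|lt] := leP (chi w) (chi u).
  have [w' uw' ew'] := on_gamma_level le; have [x_inj _ _] := hx.
  have [lx|lx|/x_inj <- //] := ltgtP (x w') (x w).
    by case: nup; exists w', w.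
  by case: nqu; exists w, w'.
case: pu => [[p' [u' [pp' uu' e lx]]]|<- //].
case: nqu; exists p', u'; split=> //; apply: on_gamma_trans qw _.
apply: on_gamma_linear pw pp' _.
by rewrite e; apply: le_trans (on_gamma_le uu') (ltW lt).
Qed.

Lemma left_of_J u v : left_of x u v -> left_of x (J v) (J u).
Proof.
move=> [u' [v' [uu' vv' e lx]]]; exists (J v'), (J u'); have [_ _ xJ] := hx.
by split; rewrite ?J_chi ?xJ ?ltrN2 //; apply: on_gammaJ.
Qed.

Lemma pairwise_rev (T : Type) (r : rel T) (s : seq T) :
  pairwise r (rev s) = pairwise (fun a b => r b a) s.
Proof.
elim: s => //= a s IHs; rewrite rev_cons pairwise_rcons all_rev IHs.
by congr (_ && _); apply: eq_all.
Qed.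

Variable s : seq R.
Hypothesis hs : leaves_left_to_right x s.

(** The reflected list is also sorted from left to right, and a left-to-right
    order on a given set of leaves is unique. *)
Lemma rev_leaves : rev [seq J v | v <- s] = s.
Proof.
have [uniq_s mem_s sorted_s] := hs.
apply: (pairwise_eq (r := fun u v => `[< left_of x u v >])) => //.
- by move=> u v /andP [/asboolP uv /asboolP /(left_of_asym uv)].
- rewrite pairwise_rev pairwise_map; apply: sub_pairwise sorted_s => u v /=.
  by move=> /asboolP uv; apply/asboolP/left_of_J.
apply: uniq_perm => // [|v].
  by rewrite rev_uniq map_inj_uniq //; apply: can_inj (@J_involutive R).
rewrite mem_rev -[v in LHS](J_involutive v).
rewrite mem_map; last exact: can_inj (@J_involutive R).
apply/idP/idP => /mem_s lv; apply/mem_s; last exact: leaf_J.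
by rewrite -[v]J_involutive; apply: leaf_J.
Qed.

End Planarity.

(** * Doubling the middle leaf *)

Lemma double_middle_odd (T : Type) (l : seq T) : odd (size l) ->
  exists a c b, [/\ size a = size b, l = a ++ c :: b &
    double_middle l = a ++ [:: c, c & b]].
Proof.
move=> o; rewrite /double_middle o; move: (odd_double_half (size l)); rewrite o.
set k := (size l)./2 => ek; have ltk : (k < size l)%N by lia.
case eb : (drop k l) => [|c b].
  by move: (congr1 size eb); rewrite size_drop /=; lia.
have ea : size (take k l) = k by rewrite size_takel // ltnW.
have el : l = take k l ++ c :: b by rewrite -eb cat_take_drop.
exists (take k l), c, b; split=> //.
  by move: (congr1 size eb); rewrite size_drop ea /=; lia.
by rewrite {1}el take_cat ea ltnNge leqnSn subSnn /= take0 -catA.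
Qed.

Lemma mem_double_middle (T : eqType) (l : seq T) : double_middle l =i l.
Proof.
have [o|e] := boolP (odd (size l)); last by rewrite /double_middle (negPf e).
have [a [c [b [_ el ed]]]] := double_middle_odd o => v; rewrite ed el.
by rewrite !mem_cat !inE; case: (v == c).
Qed.

Lemma odd_double_middle (T : Type) (l : seq T) :
  ~~ odd (size (double_middle l)).
Proof.
have [o|e] := boolP (odd (size l)); last by rewrite /double_middle (negPf e).
have [a [c [b [eab _ ->]]]] := double_middle_odd o.
by rewrite size_cat /= eab; lia.
Qed.

Lemma rev_double_middle (T : eqType) (f : T -> T) (l : seq T) :
  rev [seq f v | v <- l] = l ->
  rev [seq f v | v <- double_middle l] = double_middle l.
Proof.
have [o|e] := boolP (odd (size l)); last by rewrite /double_middle (negPf e).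
have [a [c [b [eab el ed]]]] := double_middle_odd o; rewrite ed el.
rewrite !map_cat !rev_cat /= !rev_cons -!cats1 -!catA /= => /eqP.
rewrite eqseq_cat ?size_rev ?size_map // => /andP [/eqP -> /eqP [-> ->]].
by [].
Qed.

Lemma pairwise_double_middle (T : Type) (r : rel T) (l : seq T) :
  reflexive r -> pairwise r l -> pairwise r (double_middle l).
Proof.
move=> rr; have [o|e] := boolP (odd (size l)); last first.
  by rewrite /double_middle (negPf e).
have [a [c [b [_ el ed]]]] := double_middle_odd o; rewrite ed el.
rewrite !pairwise_cat !allrel_consr /= rr.
move=> /and3P [/andP [-> ->] -> /andP [-> ->]].
by [].
Qed.

(** * Equivariant maps between planar lists of leaves *)

(** The only consequence of planarity that the chain maps need. *)
Definition planar_list (R : graded_root) (l : seq R) :=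
  forall (p q : 'I_(size l)) (k : 'I_(size l).-1), between p q k ->
    gr (meet (vertex p) (vertex q)) <= gr_alpha k.

Lemma planar_list_of_drawing (R : sym_root) (x : R -> rat) (l : seq R) :
  symmetric_drawing x -> pairwise (fun u v => `[< weakly_left x u v >]) l ->
  planar_list l.
Proof.
move=> hx sorted_l p q k.
wlog lepq : p q / (p <= q)%N => [th|].
  case: (leqP p q) => [/th //|/ltnW/th h pqk].
  by rewrite gr_meetC; apply: h; rewrite /between eq_sym.
have weak (i j : 'I_(size l)) : (i <= j)%N ->
    weakly_left x (vertex i) (vertex j).
  rewrite leq_eqVlt => /orP [/eqP/val_inj ->|lt_ij]; first by right.
  have x0 : R := vertex i.
  move/(pairwiseP x0): sorted_l => /(_ i j (ltn_ord i) (ltn_ord j) lt_ij).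
  by move/asboolP; rewrite /vertex !(tnth_nth x0).
have [pw qw _] := meetP (vertex p) (vertex q).
have conv (i : 'I_(size l)) : (p <= i)%N -> (i <= q)%N ->
    on_gamma (vertex i) (meet (vertex p) (vertex q)).
  by move=> pi iq; apply: on_gamma_between pw qw; [exact: hx | exact: weak..].
move=> pqk; apply/meet_geP; exists (meet (vertex p) (vertex q)).
by split=> //; apply: conv => /=; move: pqk; rewrite /between; lia.
Qed.

Lemma vertex_rev (R : sym_root) (l : seq R) (i : 'I_(size l)) :
  rev [seq J v | v <- l] = l -> vertex (rev_ord i) = J (vertex i).
Proof.
move=> sym_l; have x0 : R := vertex i.
rewrite /vertex !(tnth_nth x0) /= -{1}sym_l.
have lt_i := ltn_ord i.
rewrite nth_rev size_map; last by lia.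
by rewrite (nth_map x0); [congr (J (nth _ _ _)); lia | lia].
Qed.

Lemma symmetric_list_of_rev (R : sym_root) (l : seq R) :
  rev [seq J v | v <- l] = l -> symmetric_list l.
Proof.
move=> sym_l; split=> [i|k]; first by rewrite vertex_rev // gr_J.
rewrite /gr_alpha ord_left_rev ord_right_rev !vertex_rev // gr_meetJ.
exact: gr_meetC.
Qed.

Lemma vertex_mem (R : graded_root) (l : seq R) (i : 'I_(size l)) :
  vertex i \in l.
Proof. exact: mem_tnth. Qed.

Section LeafMorphism.
Variables (R R' : sym_root) (l : seq R) (l' : seq R') (h : R -> R').
Hypotheses (sym_l : rev [seq J v | v <- l] = l)
  (sym_l' : rev [seq J v | v <- l'] = l').
Hypotheses (even_l : ~~ odd (size l)) (planar_l' : planar_list l').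
Hypothesis h_mem : forall v, v \in l -> h v \in l'.
Hypothesis h_gr : forall v, v \in l -> even_le (gr v) (gr (h v)).
Hypothesis h_meet : forall u v, u \in l -> v \in l ->
  gr (meet u v) <= gr (meet (h u) (h v)).
Hypothesis h_meetJ : forall v, v \in l ->
  gr (meet v (J v)) <= gr (meet (h v) (J (h v))).

(** Positions in the left half follow h and those in the right half are their
    mirror images. Positions rather than leaves matter here, because h may send
    a leaf to the doubled middle leaf, whose two copies have to be exchanged.
    The two middle positions hold v and J v, which is where the condition on the
    meet of h v and J (h v) is used. *)
Lemma equivariant_leaf_morphism :
  exists phi : 'I_(size l) -> 'I_(size l'),
    leaf_morphism phi /\ forall i, phi (rev_ord i) = rev_ord (phi i).
Proof.
have /choice [psi psiP] : forall i : 'I_(size l), exists j : 'I_(size l'),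
    vertex j = h (vertex i).
  move=> i; have hi := h_mem (vertex_mem i).
  have lt_hi : (index (h (vertex i)) l' < size l')%N by rewrite index_mem.
  exists (Ordinal lt_hi).
  by rewrite /vertex (tnth_nth (h (vertex i))) /= nth_index.
pose phi (i : 'I_(size l)) :=
  if (i < rev_ord i)%N then psi i else rev_ord (psi (rev_ord i)).
have phiL (i : 'I_(size l)) : (i < rev_ord i)%N ->
    vertex (phi i) = h (vertex i).
  by rewrite /phi => ->; apply: psiP.
have phiR (i : 'I_(size l)) : ~~ (i < rev_ord i)%N ->
    vertex (phi i) = J (h (J (vertex i))).
  by rewrite /phi => /negPf ->; rewrite vertex_rev // psiP vertex_rev.
have phi_rev (i : 'I_(size l)) : phi (rev_ord i) = rev_ord (phi i).
  rewrite /phi rev_ordK; case: ltngtP => [_|_|e] /=; rewrite ?rev_ordK //.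
  by move: e even_l; rewrite /=; have := ltn_ord i; lia.
exists phi; split=> //.
have le_gr (i : 'I_(size l)) : even_le (gr (vertex i)) (gr (vertex (phi i))).
  have [lt|ge] := boolP (i < rev_ord i)%N.
    by rewrite phiL //; apply: h_gr; apply: vertex_mem.
  rewrite phiR // gr_J -[gr (vertex i)]gr_J; apply: h_gr.
  by rewrite -vertex_rev //; apply: vertex_mem.
split=> // i k ik.
apply: even_le_transfer (even_le_trans (alpha_left i) (le_gr _)) _.
apply: le_trans (planar_l' ik); rewrite /gr_alpha.
have [ltr|ger] := boolP (ord_right i < rev_ord (ord_right i))%N.
  rewrite !phiL //; last by move: ltr => /=; lia.
  by apply: h_meet; apply: vertex_mem.
have [ltl|gel] := boolP (ord_left i < rev_ord (ord_left i))%N.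
  have er : ord_right i = rev_ord (ord_left i).
    by apply: val_inj => /=; move: ltl ger even_l => /=; lia.
  rewrite er phi_rev !vertex_rev // phiL //.
  by apply: h_meetJ; apply: vertex_mem.
rewrite !phiR // gr_meetJ -gr_meetJ -!vertex_rev //.
by apply: h_meet; apply: vertex_mem.
Qed.

End LeafMorphism.

(** * Clusters and the leaves of the monotone subroot *)

(** Any bound of the degrees, rounded up to the right class mod 2. *)
Lemma even_upper_bound (R : graded_root) :
  exists D, forall v : R, even_le (gr v) D.
Proof.
have [v0 _] := root_infinite (g := R) [::]; have [B leB] := chi_bounded R.
pose n := (Num.truncn `|B - chi v0|).+1.
have ltB : B < chi v0 + n%:R.
  by rewrite -ltrBlDl; apply: le_lt_trans (ler_norm _) (truncnS_gt _).
exists (gr v0 + 2 * n%:R) => v; have [m em] := intrP (chi_int v0 v).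
have mn0 : 0 <= m + n%:Z.
  by rewrite -(ler0z rat) rmorphD /= -em -pmulrn; have := leB v; lra.
exists (absz (m + n%:Z)); rewrite natr_absz ger0_norm //.
by rewrite rmorphD /= -em -pmulrn /gr; lra.
Qed.

Section Clusters.
Variable R : sym_root.
Implicit Types (u v w : R) (b q : rat) (S : seq R).

(** The base of u is at least q. *)
Definition reaches u q := exists w, [/\ on_gamma u w, stem w & q <= gr w].

Lemma cluster_reaches b u : cluster b u -> reaches u b.
Proof. by move=> [[w [uw sw <-]] _]; exists w. Qed.

Lemma reaches_trans u q b : reaches u b -> q <= b -> reaches u q.
Proof.
by move=> [w [uw sw le]] le'; exists w; split=> //; apply: le_trans le.
Qed.

Lemma reaches_J u q : reaches u q -> reaches (J u) q.
Proof.
by move=> [w [/on_gammaJ uw sw le]]; exists w; split=> //; rewrite sw in uw.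
Qed.

Lemma reaches_le u q : reaches u q -> q <= gr u.
Proof.
move=> [w [/on_gamma_le le sw le']]; apply: le_trans le' _.
by rewrite le_gr_chi.
Qed.

(** The stem is itself a descending path: of the stem vertices reached by u and
    v, the lower one lies below both. *)
Lemma reaches_meet u v q : reaches u q -> reaches v q -> q <= gr (meet u v).
Proof.
move=> [w [uw sw le]] [w' [vw' sw' le']]; apply/meet_geP.
have [lew|/ltW lew] := leP (chi w) (chi w').
  exists w; split=> //; apply: on_gamma_trans vw' _.
  exact: stem_linear.
exists w'; split=> //; apply: on_gamma_trans uw _.
exact: stem_linear.
Qed.

(** The path from v enters the stem where it meets its mirror image. *)
Lemma cluster_meetJ v : cluster (gr (meet v (J v))) v.
Proof.
have [vm jm max] := meetP v (J v); split.
  by exists (meet v (J v)); split=> //; apply: meet_J_stem vm jm.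
move=> w vw sw; apply: max => //.
by have := on_gammaJ vw; rewrite sw.
Qed.

(** Above its base a path avoids the stem, so two paths that meet above one of
    the bases enter the stem at the same vertex. *)
Lemma cluster_meet b b' u v : cluster b u -> cluster b' v -> b <> b' ->
  gr (meet u v) <= b.
Proof.
move=> [[w [uw sw ew]] maxu] [[w' [vw' sw' ew']] maxv] ne.
have [um vm _] := meetP u v; rewrite leNgt; apply/negP => lt.
have mw : on_gamma (meet u v) w.
  by apply: on_gamma_linear um uw _; rewrite -le_gr_chi ew ltW.
have le_bb' : b <= b'.
  by rewrite -ew; apply: maxv sw; apply: on_gamma_trans vm mw.
have [le|/ltW le] := leP (gr w') (gr (meet u v)).
  have mw' : on_gamma (meet u v) w'.
    by apply: on_gamma_linear vm vw' _; rewrite -le_gr_chi.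
  case: ne; apply/le_anti; rewrite le_bb' -ew' maxu //.
  exact: on_gamma_trans um mw'.
have := maxu _ um; rewrite leNgt lt => /(_ _)/negP; case=> //.
apply: stem_gamma sw' _; apply: on_gamma_linear vw' vm _.
by rewrite -le_gr_chi.
Qed.

Lemma stem_cluster w : stem w -> cluster (gr w) w.
Proof.
move=> sw; split; first by exists w; split=> //; apply: on_gamma_refl.
by move=> w' /on_gamma_le le _; rewrite le_gr_chi.
Qed.

Lemma trivial_cluster b u v : ~ nontrivial R b -> cluster b u -> cluster b v ->
  u = v.
Proof. by move=> nt cu cv; apply: contrapT => ne; apply: nt; exists u, v. Qed.

Lemma foldl_tips_sub (tip : rat -> R) S bs :
  {subset S <= foldl (add_tips tip) S bs}.
Proof.
elim: bs S => [|b bs IHbs] S v vS //=; apply: IHbs; rewrite /add_tips.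
by case: ifP => // _; rewrite !inE vS !orbT.
Qed.

Lemma foldl_tips_ind (Q : R -> Prop) (tip : rat -> R) S bs :
  (forall u, u \in S -> Q u) ->
  (forall b, b \in bs -> Q (tip b) /\ Q (J (tip b))) ->
  forall u, u \in foldl (add_tips tip) S bs -> Q u.
Proof.
elim: bs S => [|b bs IHbs] S QS Qbs //=; apply: IHbs => [u|b' bs'].
  rewrite /add_tips; case: ifP => _; last exact: QS.
  rewrite !inE; have [Qt QJt] := Qbs b (mem_head _ _).
  by case/or3P => [/eqP ->|/eqP ->|/QS].
by apply: Qbs; rewrite inE bs' orbT.
Qed.

(** Tips are leaves by choice. If the cluster of the uppermost stem vertex is
    trivial, that vertex is a leaf, as an upper neighbour would have the same
    base. *)
Lemma monotone_leaves_leaf S u : monotone_leaves S -> u \in S -> leaf u.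
Proof.
move=> [top [tip [bs [[stop maxtop] tipP bsP _ ->]]]]; move: u.
apply: foldl_tips_ind => [u|b /bsP [_ /tipP [lt _ _ _ _]]]; last first.
  by split=> //; apply: leaf_J.
case: asboolP => [/tipP [lt _ _ _ _]|triv]; rewrite !inE.
  by case/orP => /eqP -> //; apply: leaf_J.
move=> /eqP ->; apply: leaf_intro => w e.
case: (chi_edge e) => ec; first by apply: down_unique => //; lra.
have ew : top = down w by apply: down_unique; [rewrite edge_sym | lra].
have wtop : on_gamma w top by rewrite ew; apply: (on_gamma_iter 1).
suff wE : w = top.
  by move: ec; rewrite wE subrr => /eqP; rewrite eq_sym oppr_eq0 oner_eq0.
apply: trivial_cluster triv _ (stem_cluster stop).
by split=> [|w' _ /maxtop //]; exists top.
Qed.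

(** Compare with the moment at which C_b is examined: the leaves present then
    have larger bases, and either one of them is as high as the tips of C_b, or
    the tips are added. A trivial cluster consists of a stem vertex, and lies
    below the leaves chosen at the start. *)
Lemma dominating_leaf S b v : monotone_leaves S -> cluster b v ->
  exists u, [/\ u \in S, reaches u b &
    forall v', cluster b v' -> gr v' <= gr u].
Proof.
move=> [top [tip [bs [[stop maxtop] tipP bsP sorted_bs ->]]]].
move=> [[w [vw sw ew]] maxv]; set r := gr top in bsP *.
have le_br : b <= r by rewrite -ew maxtop.
set S0 := if _ then _ else _.
have S0r u : u \in S0 -> reaches u r.
  rewrite /S0; case: asboolP => [/tipP [_ _ cr _ _]|_]; rewrite !inE.
    by case/orP => /eqP ->; [|apply: reaches_J]; apply: cluster_reaches.
  by move=> /eqP ->; apply: cluster_reaches (stem_cluster stop).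
(* u0 is one of the leaves with which the construction starts. *)
have [u0 [u0S maxu0]] : exists u0, u0 \in S0 /\
    forall v', cluster r v' -> gr v' <= gr u0.
  rewrite /S0; case: asboolP => [/tipP [_ _ _ _ max]|triv].
    by exists (tip r); rewrite mem_head.
  exists top; rewrite mem_head; split=> // v' cv'.
  by rewrite (trivial_cluster triv cv' (stem_cluster stop)).
have [eb|lt_br] := eqVneq b r.
  rewrite eb; exists u0; split=> //; [exact: foldl_tips_sub | exact: S0r].
have {}lt_br : b < r by rewrite lt_neqAle lt_br.
have [nb|nb] := pselect (nontrivial R b); last first.
  exists u0; split; first exact: foldl_tips_sub.
    by apply: reaches_trans le_br; apply: S0r.
  move=> v' cv'; have cw : cluster b w by rewrite -ew; apply: stem_cluster.
  rewrite (trivial_cluster nb cv' cw) ew; apply: le_trans le_br _.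
  exact/reaches_le/S0r.
have [_ _ cb _ maxb] := tipP b nb.
have bbs : b \in bs by apply/bsP.
move: sorted_bs bsP; case/splitPr: bbs => bs1 bs2 sorted_bs bsP.
(* S1 is the set of leaves at the moment when C_b is examined. *)
rewrite foldl_cat /=; set S1 := foldl _ S0 bs1.
have S1b u : u \in S1 -> reaches u b.
  move: u; apply: (foldl_tips_ind (Q := reaches^~ b)) => [u /S0r h|b' b'bs].
    exact: reaches_trans h _.
  have /bsP [_ /tipP [_ _ cb' cJb' _]] : b' \in bs1 ++ b :: bs2.
    by rewrite mem_cat b'bs.
  have le_bb' : b <= b'.
    move: sorted_bs; rewrite sorted_pairwise; last first.
      by move=> x y z xy yz; apply: lt_trans yz xy.
    rewrite pairwise_cat allrel_consr.
    move=> /and3P [/andP [/allP/(_ _ b'bs) lt _] _ _].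
    exact: ltW.
  by split; apply: reaches_trans le_bb'; apply: cluster_reaches.
have [all_lt|] := boolP (all (fun u => gr u < gr (tip b)) S1).
  exists (tip b); split=> //; last exact: cluster_reaches.
  by apply: foldl_tips_sub; rewrite /add_tips all_lt mem_head.
move=> /allPn [u uS1]; rewrite -leNgt => le_tip; exists u; split.
- apply: foldl_tips_sub; rewrite /add_tips; case: ifP => // _.
  by rewrite !inE uS1 !orbT.
- exact: S1b.
by move=> v' /maxb h; apply: le_trans le_tip.
Qed.

End Clusters.

(** * The embedding of the subroot *)

Section Subroot.
Variables (R M : sym_root) (S : seq R) (f : M -> R).
Hypothesis fP : subroot_spanned S f.

Lemma subroot_gr m : gr (f m) = gr m.
Proof. by have [_ _ _ fc _] := fP; rewrite /gr fc. Qed.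

Lemma subroot_down m : f (down m) = down (f m).
Proof.
have [_ _ fe fc _] := fP; have [e l] := downP m.
by apply: down_unique; rewrite ?fe ?fc.
Qed.

Lemma subroot_iter_down n m : f (iter n (@down M) m) = iter n (@down R) (f m).
Proof. by elim: n => //= n <-; rewrite subroot_down. Qed.

Lemma subroot_on_gamma m w : on_gamma (f m) w ->
  exists2 n, on_gamma m n & f n = w.
Proof.
move=> /on_gammaP [k ->]; exists (iter k (@down M) m).
  exact: on_gamma_iter.
exact: subroot_iter_down.
Qed.

Lemma on_gamma_subroot m n : on_gamma m n <-> on_gamma (f m) (f n).
Proof.
have [f_inj _ _ _ _] := fP; split=> [/on_gammaP [k ->]|]; last first.
  by move=> /subroot_on_gamma [n' mn' /f_inj <-].
by rewrite subroot_iter_down; apply: on_gamma_iter.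
Qed.

Lemma subroot_meet m n : gr (meet (f m) (f n)) = gr (meet m n).
Proof.
apply/le_anti/andP; split; apply/meet_geP.
  have [mw nw _] := meetP (f m) (f n).
  have [w mw' ew] := subroot_on_gamma mw; exists w; split=> //.
    by apply/on_gamma_subroot; rewrite ew.
  by rewrite -ew subroot_gr.
have [mw nw _] := meetP m n; exists (f (meet m n)).
by split; [apply/on_gamma_subroot..| rewrite subroot_gr].
Qed.

(** A vertex of M which is not in S lies strictly below an element of S, hence
    has an upper neighbour in M. *)
Lemma subroot_leaf m : (forall u, u \in S -> leaf u) -> leaf m -> leaf (f m).
Proof.
move=> leafS lm; have [f_inj f_span fe fc _] := fP.
have /f_span [v vS /on_gammaP [[|k] ek]] : exists u, f u = f m by exists m.
  by rewrite ek; apply: leafS.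
have [n en] : exists n, f n = iter k (@down R) v.
  by apply/f_span; exists v => //; apply: on_gamma_iter.
have [e l] := downP (f n).
have emn : f m = down (f n) by rewrite ek en.
rewrite -emn !fc in l; rewrite -emn fe edge_sym in e.
have := leaf_no_upper lm e; have [_ l'] := downP m => en'.
by rewrite en' in l; have := lt_trans l l'; rewrite ltxx.
Qed.

Lemma leaf_subroot v : v \in S -> leaf v -> exists2 m, leaf m & f m = v.
Proof.
move=> vS lv; have [f_inj f_span fe fc _] := fP.
have [m em] : exists m, f m = v.
  by apply/f_span; exists v => //; apply: on_gamma_refl.
exists m => //; apply: leaf_intro => n e; apply: f_inj.
by rewrite subroot_down em; apply: leaf_no_upper => //; rewrite -em fe.
Qed.

End Subroot.

Lemma double_middle_list (R : sym_root) (x : R -> rat) (s : seq R) :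
  symmetric_drawing x -> leaves_left_to_right x s ->
  let l := double_middle s in
  [/\ rev [seq J v | v <- l] = l, ~~ odd (size l), planar_list l &
      forall v, v \in l <-> leaf v].
Proof.
move=> hx hs l; split.
- exact/rev_double_middle/(rev_leaves hx hs).
- exact: odd_double_middle.
- apply: (planar_list_of_drawing hx); apply: pairwise_double_middle.
    by move=> v; apply/asboolP; right.
  have [_ _] := hs; apply: sub_pairwise => u v /asboolP uv.
  by apply/asboolP; left.
by move=> v; rewrite mem_double_middle; have [_ + _] := hs; apply.
Qed.

(** * Local equivalence with the monotone subroot *)

(* (x, s) and (y, t) are symmetric planar drawings of R and of M with the leaves
   listed from left to right. *)
Theorem theorem6p1 (R M : sym_root) (hM : monotone_subroot R M)
  (x : R -> rat) (s : seq R)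
  (hx : symmetric_drawing x) (hs : leaves_left_to_right x s)
  (y : M -> rat) (t : seq M)
  (hy : symmetric_drawing y) (ht : leaves_left_to_right y t) :
  locally_equivalent (std_J (double_middle s)) (std_J (double_middle t)).
Proof.
have [S [f [mS fP]]] := hM.
have [rev_s even_s planar_s mem_s] := double_middle_list hx hs.
have [rev_t even_t planar_t mem_t] := double_middle_list hy ht.
set s2 := double_middle s in rev_s even_s planar_s mem_s *.
set t2 := double_middle t in rev_t even_t planar_t mem_t *.
have leafS u : u \in S -> leaf u := monotone_leaves_leaf mS.
(* h chooses, for each base, one leaf of M that dominates the whole cluster. *)
have /choice [h hP] : forall b, exists m : M, forall v : R, cluster b v ->
    [/\ m \in t2, reaches (f m) b & gr v <= gr m].
  move=> b; have [m0 _] := root_infinite (g := M) [::].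
  have [[v cv]|none] := pselect (exists v : R, cluster b v); last first.
    by exists m0 => v cv; case: none; exists v.
  have [u [uS ub maxu]] := dominating_leaf mS cv.
  have [m lm em] := leaf_subroot fP uS (leafS u uS).
  exists m => v' cv'; rewrite em -(subroot_gr fP) em.
  by split; [apply/mem_t | | apply: maxu].
pose base (v : R) := gr (meet v (J v)).
pose F (v : R) := h (base v).
have FP v : [/\ F v \in t2, reaches (f (F v)) (base v) & gr v <= gr (F v)].
  exact/hP/cluster_meetJ.
have [phi [phiP phi_rev]] : exists phi : 'I_(size s2) -> 'I_(size t2),
    leaf_morphism phi /\ forall i, phi (rev_ord i) = rev_ord (phi i).
  apply: (equivariant_leaf_morphism (h := F)) => //.
  - by move=> v _; case: (FP v).
  - move=> v _; rewrite -(subroot_gr fP).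
    apply: even_le_transfer (even_le_refl _) _.
    by rewrite (subroot_gr fP); case: (FP v).
  - move=> u v _ _; have [_ ru leu] := FP u; have [_ rv lev] := FP v.
    have [e|/eqP ne] := eqVneq (base u) (base v).
      rewrite /F -e; apply/meet_geP; exists (F u).
      split; try exact: on_gamma_refl.
      apply: le_trans leu; rewrite le_gr_chi; apply: on_gamma_le.
      by case: (meetP u v).
    rewrite -(subroot_meet fP); apply: reaches_meet.
      apply: reaches_trans ru _.
      by apply: cluster_meet ne; apply: cluster_meetJ.
    apply: reaches_trans rv _; rewrite gr_meetC.
    by apply: cluster_meet (nesym ne); apply: cluster_meetJ.
  move=> v _; have [_ rv _] := FP v; rewrite -(subroot_meet fP).
  have [_ _ _ _ ->] := fP; apply: reaches_meet => //; exact: reaches_J.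
have [psi [psiP psi_rev]] : exists psi : 'I_(size t2) -> 'I_(size s2),
    leaf_morphism psi /\ forall i, psi (rev_ord i) = rev_ord (psi i).
  apply: (equivariant_leaf_morphism (h := f)) => //.
  - by move=> m /mem_t lm; apply/mem_s; apply: subroot_leaf fP _ leafS lm.
  - by move=> m _; rewrite (subroot_gr fP); apply: even_le_refl.
  - by move=> m n _ _; rewrite (subroot_meet fP).
  by move=> m _; have [_ _ _ _ <-] := fP; rewrite (subroot_meet fP).
have [D leD] := even_upper_bound R.
have s_gt0 : (0 < size s2)%N.
  have [v0 _] := root_infinite (g := R) [::].
  have [Ft _ _] := FP v0; have /mem_t lF := Ft.
  have /mem_s := subroot_leaf fP leafS lF; by case: (s2).
have t_gt0 : (0 < size t2)%N.
  have [v0 _] := root_infinite (g := R) [::].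
  by have [+ _ _] := FP v0; case: (t2).
have sD (i : 'I_(size s2)) : even_le (gr (vertex i)) D by apply: leD.
have tD (i : 'I_(size t2)) : even_le (gr (vertex i)) D.
  by rewrite -(subroot_gr fP); apply: leD.
have sym_s := symmetric_list_of_rev rev_s.
have sym_t := symmetric_list_of_rev rev_t.
split.
- exact: std_iota_complex s_gt0 sD sym_s.
- exact: std_iota_complex t_gt0 tD sym_t.
- by exists (leaf_map phi); apply: leaf_map_local sD tD _ _ _ _.
by exists (leaf_map psi); apply: leaf_map_local tD sD _ _ _ _.
Qed.
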